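(* Let $r\ge 2$ and $s>1$ be integers, and let $F$ be a graph whose connected components consist of $s$ components of chromatic number $r+1$, each having a color-critical edge, together with any number of components of chromatic number at most $r$. Let $H$ be a weakly $F$-Turán-stable graph. Then for $n$ sufficiently large, $\mathrm{ex}(n,H,F)=\mathcal{N}(H,T)$ for some $n$-vertex complete $(s+r-1)$-partite graph $T$ having $s-1$ parts of order $1$.
   Context: All graphs are finite and simple. $\mathcal{N}(H,G)$ is the number of subgraphs of $G$ isomorphic to $H$, and $\mathrm{ex}(n,H,F)$ is the maximum of $\mathcal{N}(H,G)$ over $n$-vertex $F$-free graphs $G$. An edge $e$ of a graph $F_0$ is color-critical if $\chi(F_0-e)<\chi(F_0)$. The edit distance between two graphs on the same vertex set is the least number of edges one must add and delete to turn one into the other. $H$ is weakly $F$-Turán-stable if every $n$-vertex $F$-free graph $G$ with $\mathcal{N}(H,G)\ge \mathrm{ex}(n,H,F)-o(n^{|V(H)|})$ has edit distance $o(n^2)$ from some complete $(\chi(F)-1)$-partite graph on $V(G)$ (asymptotics as $n\to\infty$ with $F,H$ fixed). *)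

(* Defs.v *)
From mathcomp Require Import all_boot all_order all_algebra.
Set Implicit Arguments. Unset Strict Implicit. Unset Printing Implicit Defensive.
Import Order.TTheory GRing.Theory Num.Theory.

Section Graphs.
Variable V : finType.

Definition is_graph (E : {set {set V}}) : bool := [forall e in E, #|e| == 2].

Definition adjE (E : {set {set V}}) : rel V := fun x y => [set x; y] \in E.

Definition comps (E : {set {set V}}) : {set {set V}} :=
  [set [set y | connect (adjE E) x y] | x : V].

Definition colorable_on (C : {set V}) (E : {set {set V}}) (k : nat) : bool :=
  [exists c : {ffun V -> 'I_k},
     [forall x in C, forall y in C, ([set x; y] \in E) ==> (c x != c y)]].

(* chromatic number of the graph (C, edges of E inside C): least k <= |V|
   admitting a proper colouring (k = #|V| always works for a simple graph). *)
Definition chi_on (C : {set V}) (E : {set {set V}}) : nat :=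
  find (colorable_on C E) (iota 0 #|V|.+1).

Definition chi (E : {set {set V}}) : nat := chi_on setT E.

Definition color_critical_edge (C : {set V}) (E : {set {set V}}) (e : {set V}) : bool :=
  [&& e \in E, e \subset C & chi_on C (E :\ e) < chi_on C E].

Definition edit_dist (E1 E2 : {set {set V}}) : nat := #|E1 :\: E2| + #|E2 :\: E1|.

Definition complete_partite_by (k : nat) (p : {ffun V -> 'I_k}) (E : {set {set V}}) : bool :=
  [forall i : 'I_k, [exists x, p x == i]] &&
  (E == [set e : {set V} | [exists x, exists y, (p x != p y) && (e == [set x; y])]]).

Definition complete_partite (k : nat) (E : {set {set V}}) : bool :=
  [exists p : {ffun V -> 'I_k}, complete_partite_by p E].

End Graphs.

Definition subcount (VH : finType) (EH : {set {set VH}}) (V : finType) (E : {set {set V}}) : nat :=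
  #|[set p : {set V} * {set {set V}} |
      (p.2 \subset E) &&
      [exists f : {ffun VH -> V},
         [&& injectiveb f, f @: setT == p.1 & p.2 == [set f @: e | e : {set VH} in EH]]]]|.

Definition ex (n : nat) (VH : finType) (EH : {set {set VH}}) (VF : finType) (EF : {set {set VF}}) : nat :=
  \max_(E : {set {set 'I_n}} | is_graph E && (subcount EF E == 0)) subcount EH E.

(* weak F-Turan-stability of H, in the equivalent epsilon-delta form of the
   o(.)-statement. *)
Definition weakly_turan_stable (VH : finType) (EH : {set {set VH}}) (VF : finType) (EF : {set {set VF}}) : Prop :=
  forall eps : rat, (0 < eps)%R -> exists delta : rat, (0 < delta)%R /\ exists n0 : nat,
    forall n : nat, (n0 <= n)%N -> forall G : {set {set 'I_n}},
      is_graph G -> subcount EF G = 0%N ->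
      ((ex n EH EF)%:R - delta * (n%:R) ^+ #|VH| <= (subcount EH G)%:R :> rat)%R ->
      exists T : {set {set 'I_n}}, complete_partite (chi EF).-1 T /\
        ((edit_dist G T)%:R <= eps * (n%:R) ^+ 2 :> rat)%R.

(* Main.v *)
Require Import Defs.
From mathcomp Require Import all_boot all_order all_algebra all_fingroup.
From mathcomp Require Import zify.
Set Implicit Arguments. Unset Strict Implicit. Unset Printing Implicit Defensive.

(** Comparing numbers of copies of [H] is the same as comparing numbers of
    injective homomorphisms. If an extremal graph were close to an [r]-partite
    graph with a sublinear class, that class could be dissolved at little cost,
    and adding a complete bipartite graph inside a large class (missing part of
    it) would give an almost extremal [F]-free graph far from every complete
    [r]-partite graph, against stability. So the extremal graph [G] is close to
    a complete [r]-partite graph with linear classes.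

    Let [B] be the set of vertices with linearly many neighbours in every
    class, and put every other vertex into a class where it has few neighbours.
    A vertex of [B], or an edge inside a class whose ends are joined to almost
    everything outside it, can absorb the critical edge of one component of
    [F]; greedily the rest of [F] is embedded, so fewer than [s] disjoint such
    objects exist. Hence, after completing [B] to [s - 1] vertices, the edges of
    [G] lying outside the complete multipartite graph [T] with the vertices of
    the completed [B] as singleton classes are few compared with the edges of
    [T] missing in [G]. Every edge of [T] lies in order [n ^ (|H| - 2)] copies of
    [H], so [T], which is [F]-free, has at least as many copies of [H] as [G]. *)

(** * Graphs, colourings and components *)

Section Graphs.
Variable V : finType.
Implicit Types (C D : {set V}) (E : {set {set V}}).

Lemma graph_edge_neq E x y : is_graph E -> [set x; y] \in E -> x != y.
Proof.
by move/forall_inP=> h /h; rewrite cards2; case: (x == y).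
Qed.

Lemma graph_edgeP E e :
  is_graph E -> e \in E -> exists x y, x != y /\ e = [set x; y].
Proof.
move=> /forall_inP h /h /cards2P [x [y [xy ->]]].
by exists x, y.
Qed.

Lemma colorable_onP C E k :
  reflect (exists c : V -> 'I_k,
             {in C &, forall x y, [set x; y] \in E -> c x != c y})
          (colorable_on C E k).
Proof.
apply: (iffP existsP) => [[c hc]|[c hc]].
  exists c => x y xC yC xy.
  by move/forall_inP: hc => /(_ x xC) /forall_inP /(_ y yC) /implyP /(_ xy).
exists [ffun x => c x]; apply/forall_inP => x xC; apply/forall_inP => y yC.
by apply/implyP => xy; rewrite !ffunE; exact: hc.
Qed.

Lemma colorable_on_leq C E k l :
  k <= l -> colorable_on C E k -> colorable_on C E l.
Proof.
move=> kl /colorable_onP [c hc]; apply/colorable_onP.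
exists (fun x => widen_ord kl (c x)) => x y xC yC xy.
by have := hc x y xC yC xy; rewrite -!val_eqE.
Qed.

Lemma colorable_on_card C E : is_graph E -> colorable_on C E #|V|.
Proof.
move=> gE; apply/colorable_onP; exists enum_rank => x y _ _ xy.
by rewrite (inj_eq enum_rank_inj); exact: graph_edge_neq xy.
Qed.

(** Giving each vertex its own colour makes the search in [chi_on] succeed; together with
    monotonicity in the number of colours this identifies the value found as a threshold. *)
Lemma chi_on_leP C E k : is_graph E -> (chi_on C E <= k) = colorable_on C E k.
Proof.
move=> gE; set s := iota 0 #|V|.+1.
have hs : has (colorable_on C E) s.
  apply/hasP; exists #|V|; last exact: colorable_on_card.
  by rewrite mem_iota /= add0n ltnS leqnn.
have lt_s : chi_on C E < #|V|.+1 by move: hs; rewrite has_find size_iota.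
apply/idP/idP => [le_k|ck].
  apply: colorable_on_leq le_k _.
  by have := nth_find 0 hs; rewrite nth_iota.
rewrite leqNgt; apply/negP => lt_k.
have := before_find 0 lt_k; rewrite nth_iota ?add0n ?ck //.
exact: ltn_trans lt_k lt_s.
Qed.

Definition component E (x : V) := [set y | connect (adjE E) x y].

Lemma adjE_sym E : symmetric (adjE E).
Proof. by move=> x y; rewrite /adjE setUC. Qed.

Lemma mem_component E x : x \in component E x.
Proof. by rewrite inE. Qed.

Lemma component_in_comps E x : component E x \in comps E.
Proof. by apply/imsetP; exists x. Qed.

Lemma component_eq E x y : y \in component E x -> component E x = component E y.
Proof.
rewrite inE => xy; apply/setP=> z; rewrite !inE.
by rewrite (same_connect (sym_connect_sym (@adjE_sym E)) xy).
Qed.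

Lemma comps_component E C x : C \in comps E -> x \in C -> C = component E x.
Proof. by case/imsetP => y _ -> /component_eq. Qed.

Lemma edge_component E x y : [set x; y] \in E -> component E x = component E y.
Proof. by move=> xy; apply: component_eq; rewrite inE connect1. Qed.

(** An edge comes from at most two ordered pairs of ends. *)
Lemma card_pairs E :
  #|[set z : V * V | [set z.1; z.2] \in E]| <= 2 * #|E|.
Proof.
set A := [set z : V * V | _].
rewrite -sum1_card (partition_big (fun z => [set z.1; z.2]) (mem E)) /=; last first.
  by move=> z; rewrite inE.
rewrite mulnC -sum_nat_const; apply: leq_sum => e _.
case: (pickP [pred z : V * V | [set z.1; z.2] == e]) => [[x y] /= /eqP xy|none].
  rewrite sum1_card; apply: leq_trans (_ : #|[set (x, y); (y, x)]| <= _); last first.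
    by rewrite cards2; case: eqP.
  apply: subset_leq_card; apply/subsetP => -[a b].
  rewrite !inE /= => /andP[_ /eqP ab]; rewrite !xpair_eqE.
  have: a \in [set x; y] by rewrite xy -ab !inE eqxx.
  have: b \in [set x; y] by rewrite xy -ab !inE eqxx orbT.
  have: x \in [set a; b] by rewrite ab -xy !inE eqxx.
  have: y \in [set a; b] by rewrite ab -xy !inE eqxx orbT.
  rewrite !inE (eq_sym x a) (eq_sym x b) (eq_sym y a) (eq_sym y b).
  by case: (a == x); case: (b == y); case: (a == y); case: (b == x).
rewrite big_pred0 // => z; have := none z; rewrite /= => ->; exact: andbF.
Qed.

Lemma sum_deg_le E : \sum_x #|[set y | [set x; y] \in E]| <= 2 * #|E|.
Proof.
apply: leq_trans (card_pairs E).
rewrite -sum1_card (partition_big (fun z => z.1) predT) //=.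
apply: leq_sum => x _; rewrite sum1_card.
rewrite -(card_imset _ (f := fun y => (x, y))); last by move=> ? ? [].
apply: subset_leq_card; apply/subsetP => _ /imsetP[y + ->].
by rewrite !inE /= => h; rewrite unfold_in /= inE /= h eqxx.
Qed.

Lemma exists_subset_card (A : {set V}) a : a <= #|A| -> exists2 B : {set V}, B \subset A & #|B| = a.
Proof.
move=> aA; exists [set x in take a (enum A)].
  by apply/subsetP => x; rewrite inE => /mem_take; rewrite mem_enum.
rewrite cardsE (card_uniqP _) ?size_takel -?cardE //.
exact: take_uniq (enum_uniq _).
Qed.

End Graphs.

Lemma leq_card_bigcup (I V : finType) (P : pred I) (A : I -> {set V}) :
  #|\bigcup_(i | P i) A i| <= \sum_(i | P i) #|A i|.
Proof.
apply: (big_ind2 (fun (X : {set V}) k => #|X| <= k)) => //; first by rewrite cards0.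
move=> X k Y l hX hY; have [h _] := leq_card_setU X Y.
by apply: leq_trans h _; exact: leq_add.
Qed.

(** The sets are chosen one after another: before each choice at most [(#|W| - 1) * a] elements are
    used up, so [a] elements are still free. *)
Lemma disjoint_subsets (W V : finType) (A : W -> {set V}) a :
  (forall w, #|W| * a <= #|A w|) ->
  exists B : W -> {set V}, (forall w, B w \subset A w /\ #|B w| = a) /\
    (forall w w', w != w' -> [disjoint B w & B w']).
Proof.
move=> hA.
(* The induction over the enumeration of [W] carries a set [U] that contains all sets chosen so far
   and bounds their total size. *)
have [B [U [hB dB _]]] : exists (B : W -> {set V}) (U : {set V}),
    [/\ {in enum W, forall w, [/\ B w \subset A w, #|B w| = a & B w \subset U]},
        {in enum W &, forall w w', w != w' -> [disjoint B w & B w']} &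
        #|U| <= size (enum W) * a].
  have : size (enum W) <= #|W| by rewrite -cardE.
  have := enum_uniq W; elim: (enum W) => [|x l IH] /=.
    by exists (fun=> set0), set0; split; rewrite ?cards0.
  move=> /andP[xl ul] sl; have [B [U [hB dB cU]]] := IH ul (ltnW sl).
  have [X XA cX] : exists2 X : {set V}, X \subset A x :\: U & #|X| = a.
    apply: exists_subset_card; rewrite cardsD.
    have : #|A x :&: U| <= #|U| by apply: subset_leq_card; exact: subsetIr.
    have := hA x; have : (size l).+1 * a <= #|W| * a by rewrite leq_mul2r sl orbT.
    rewrite mulSn; lia.
  have dX w : w \in l -> [disjoint X & B w].
    move=> wl; have [_ _ wU] := hB w wl.
    rewrite disjoints_subset; apply: subset_trans XA _; apply/subsetP => z.
    rewrite !inE => /andP[zU _]; apply: contra zU; exact: (subsetP wU).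
  have neq w : w \in l -> (w == x) = false by move=> wl; apply: contraNF xl => /eqP <-.
  exists (fun w => if w == x then X else B w), (X :|: U); split.
  - move=> w; rewrite inE; case: eqP => [-> _|_ /= wl].
      by split=> //; [apply: subset_trans XA (subsetDl _ _) | exact: subsetUl].
    by have [? ? ?] := hB w wl; split=> //; apply: subset_trans (subsetUr _ _).
  - move=> w w'; rewrite !inE.
    case/predU1P => [->|wl] /predU1P [->|wl'] ww'; rewrite ?eqxx ?neq //.
    + by rewrite eqxx in ww'.
    + exact: dX.
    + by rewrite disjoint_sym dX.
    + exact: dB.
  - by rewrite mulSn; have [+ _] := leq_card_setU X U; rewrite cX; lia.
exists B; split=> [w|w w']; first by have [] := hB w (mem_enum predT w).
by apply: dB; rewrite mem_enum.
Qed.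

(** * Counting injective homomorphisms *)

Lemma imset_pair (U V : finType) (f : U -> V) x y : f @: [set x; y] = [set f x; f y].
Proof. by rewrite imsetU !imset_set1. Qed.

Section Embeddings.
Variables (VH V : finType) (EH : {set {set VH}}).
Implicit Types (E : {set {set V}}).

Definition embs E :=
  [set f : {ffun VH -> V} | injectiveb f && [forall e in EH, f @: e \in E]].

Lemma embsP E (f : {ffun VH -> V}) : is_graph EH ->
  reflect (injective f /\ forall x y, [set x; y] \in EH -> [set f x; f y] \in E)
          (f \in embs E).
Proof.
move=> gH; rewrite inE; apply: (iffP andP) => [[/injectiveP fi /forall_inP h]|[fi h]].
  by split=> // x y /h; rewrite imset_pair.
split; first exact/injectiveP.
apply/forall_inP => e eH; have [x [y [_ exy]]] := graph_edgeP gH eH.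
by rewrite exy imset_pair h // -exy.
Qed.

Lemma card_family_ffun (F : VH -> {set V}) :
  #|[set f : {ffun VH -> V} | [forall x, f x \in F x]]| = \prod_x #|F x|.
Proof.
have -> : \prod_x #|F x| = #|(family F : simpl_pred {ffun VH -> V})|.
  by rewrite card_family foldrE big_map big_enum.
by apply: eq_card => f; rewrite !inE; apply/forallP/familyP.
Qed.

Lemma card_ffun_fix2 (u v : VH) (x y : V) : u != v ->
  #|[set f : {ffun VH -> V} | (f u == x) && (f v == y)]| = #|V| ^ (#|VH| - 2).
Proof.
move=> uv.
pose F w := if w == u then [set x] else if w == v then [set y] else setT.
have -> : [set f : {ffun VH -> V} | (f u == x) && (f v == y)] =
          [set f : {ffun VH -> V} | [forall w, f w \in F w]].
  apply/setP=> f; rewrite !inE; apply/andP/forallP => [[fu fv] w|h].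
    by rewrite /F; case: eqP => [->|_]; [|case: eqP => [->|_]]; rewrite inE.
  have := h u; have := h v; rewrite /F eqxx eq_sym (negbTE uv) eqxx.
  by rewrite !inE.
rewrite card_family_ffun (bigD1 u) // (bigD1 v) /=; last by rewrite eq_sym.
rewrite /F !eqxx eq_sym (negbTE uv) !cards1 !mul1n.
rewrite (eq_bigr (fun=> #|V|)); last first.
  by move=> w /andP[/negbTE-> /negbTE->]; rewrite cardsT.
rewrite prod_nat_const; congr (_ ^ _).
have -> : #|[pred w | (w != u) && (w != v)]| = #|~: [set u; v]|.
  by apply: eq_card => w; rewrite !inE negb_or.
by rewrite -(cardsC [set u; v]) cards2 uv addKn.
Qed.

(** An embedding that is lost sends some edge of [H] into [E1 :\: E2]. Once that edge and its
    ordered image are fixed, only [#|VH| - 2] vertices remain free. *)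
Lemma embs_lipschitz E1 E2 : is_graph EH ->
  #|embs E1| <= #|embs E2| + 2 * #|EH| * #|E1 :\: E2| * #|V| ^ (#|VH| - 2).
Proof.
move=> gH; set D := E1 :\: E2.
pose Z (d : {set VH}) := [set f : {ffun VH -> V} | f @: d \in D].
have cZ d : d \in EH -> #|Z d| <= 2 * #|D| * #|V| ^ (#|VH| - 2).
  move=> dH; have [u [v [uv ->]]] := graph_edgeP gH dH.
  rewrite -sum1_card (partition_big (fun f : {ffun VH -> V} => (f u, f v))
    (mem [set z : V * V | [set z.1; z.2] \in D])) /=; last first.
    by move=> f; rewrite !inE /= imset_pair.
  apply: leq_trans (leq_mul (card_pairs D) (leqnn _)).
  rewrite -sum_nat_const; apply: leq_sum => -[x y] _.
  rewrite -(card_ffun_fix2 x y uv) sum1_card; apply: subset_leq_card.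
  by apply/subsetP => f; rewrite !inE => /andP[_]; rewrite xpair_eqE.
have sub : embs E1 \subset embs E2 :|: \bigcup_(d in EH) Z d.
  apply/subsetP => f; rewrite !inE => /andP[fi /forall_inP fE].
  rewrite fi /=; case: (boolP [forall e in EH, _]) => //= /forall_inPn [d dH fd].
  by apply/bigcupP; exists d => //; rewrite !inE fd fE.
apply: leq_trans (subset_leq_card sub) _.
have [+ _] := leq_card_setU (embs E2) (\bigcup_(d in EH) Z d).
move=> hU; apply: leq_trans hU _; rewrite leq_add2l.
apply: leq_trans (leq_card_bigcup _ _) _.
apply: (leq_trans (n := \sum_(d in EH) 2 * #|D| * #|V| ^ (#|VH| - 2))).
  exact: leq_sum.
rewrite sum_nat_const.
by rewrite !mulnA (mulnC _ 2).
Qed.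

End Embeddings.

(** * Copies and embeddings *)

Section Copies.
Variables (VH V : finType) (EH : {set {set VH}}).

(** The embeddings with a given copy as image are obtained from one of them by composing with the
    automorphisms of [H], which are the elements of [embs EH EH]. *)
Lemma embs_subcount (E : {set {set V}}) :
  #|embs EH E| = #|embs EH EH| * subcount EH E.
Proof.
rewrite /subcount; set C := [set p | _].
pose img (f : {ffun VH -> V}) := (f @: setT, [set f @: e | e : {set VH} in EH]).
rewrite -sum1_card (partition_big img (mem C)) /=; last first.
  move=> f; rewrite !inE => /andP[fi /forall_inP fE] /=; apply/andP; split.
    by apply/subsetP => _ /imsetP [e eH ->]; exact: fE.
  by apply/existsP; exists f; rewrite fi !eqxx.
rewrite mulnC -sum_nat_const; apply: eq_bigr => -[A B].
rewrite !inE /= => /andP[BE /existsP[f0 /and3P[/injectiveP f0i /eqP f0A /eqP f0B]]].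
rewrite sum1_card.
pose comp0 (a : {ffun VH -> VH}) := [ffun x => f0 (a x)].
have comp0i : injective comp0.
  by move=> a b /ffunP ab; apply/ffunP => x; apply: f0i; have := ab x; rewrite !ffunE.
rewrite -(card_imset _ comp0i); apply: eq_card => f; apply/idP/imsetP.
  rewrite unfold_in /= inE => /andP[/andP[/injectiveP fi /forall_inP fE]] /eqP [fA fB].
  have im x : exists y, f0 y == f x.
    have : f x \in A by rewrite -fA imset_f.
    by rewrite -f0A => /imsetP [y _ ->]; exists y.
  pose a := [ffun x => xchoose (im x)].
  have ha x : f0 (a x) = f x by rewrite ffunE; exact/eqP/(xchooseP (im x)).
  exists a; last by apply/ffunP => x; rewrite ffunE ha.
  rewrite inE; apply/andP; split.
    by apply/injectiveP => x y axy; apply: fi; rewrite -!ha axy.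
  apply/forall_inP => e eH.
  have : f @: e \in B by rewrite -fB imset_f.
  rewrite f0B => /imsetP [e' e'H].
  have -> : f @: e = f0 @: (a @: e) by rewrite -imset_comp; apply: eq_imset => x /=.
  by move/(imset_inj f0i) ->.
move=> [a + ->]; rewrite inE => /andP[/injectiveP ai /forall_inP aE].
(* An injective map of a finite graph to itself that preserves edges permutes the edge set. *)
have aH : [set a @: e | e : {set VH} in EH] = EH.
  apply/eqP; rewrite eqEcard card_imset ?leqnn ?andbT; last exact: imset_inj.
  by apply/subsetP => _ /imsetP [e eH ->]; exact: aE.
have fB : [set comp0 a @: e | e : {set VH} in EH] = B.
  rewrite f0B -[in RHS]aH -imset_comp; apply: eq_imset => e /=.
  by rewrite -imset_comp; apply: eq_imset => x; rewrite ffunE.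
have fA : comp0 a @: setT = A.
  rewrite -f0A; have aT : a @: setT = setT.
    by apply/eqP; rewrite eqEcard subsetT card_imset // leqnn.
  by rewrite -[in RHS]aT -imset_comp; apply: eq_imset => x; rewrite ffunE.
rewrite unfold_in /= inE /img fA fB eqxx andbT; apply/andP; split.
  by apply/injectiveP => x y; rewrite !ffunE => /f0i /ai.
apply/forall_inP => e eH; apply: (subsetP BE); rewrite -fB; exact: imset_f.
Qed.

Lemma aut_gt0 : 0 < #|embs EH EH|.
Proof.
apply/card_gt0P; exists [ffun x => x]; rewrite inE; apply/andP; split.
  by apply/injectiveP => x y; rewrite !ffunE.
apply/forall_inP => e eH; rewrite (eq_imset (g := id)) ?imset_id // => x.
by rewrite ffunE.
Qed.

Lemma subcount_eq0 (E : {set {set V}}) : (subcount EH E == 0) = (embs EH E == set0).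
Proof.
by rewrite -cards_eq0 embs_subcount muln_eq0 (gtn_eqF aut_gt0).
Qed.

End Copies.

(** * Complete multipartite graphs with singleton classes *)

Lemma set2_eq (V : finType) (x y a b : V) : [set x; y] = [set a; b] ->
  (x = a /\ y = b) \/ (x = b /\ y = a).
Proof.
move=> e; have := set21 x y; have := set22 x y; rewrite e !inE.
have := set21 a b; have := set22 a b; rewrite -e !inE.
by move=> /orP[] /eqP ? /orP[] /eqP ? /orP[] /eqP ? /orP[] /eqP ?; intuition congruence.
Qed.

Section Joined.
Variables (V : finType) (r : nat).
Implicit Types (B : {set V}) (q : V -> 'I_r).

(** The complete multipartite graph whose classes are the single vertices of [B] and the classes of
    [q] outside [B]. In particular [joined set0 q] is complete [r]-partite, with empty classes
    allowed. *)
Definition joined B q : {set {set V}} :=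
  [set e : {set V} | [exists x, exists y,
     [&& x != y, [|| x \in B, y \in B | q x != q y] & e == [set x; y]]]].

Lemma in_joined B q x y :
  ([set x; y] \in joined B q) = (x != y) && [|| x \in B, y \in B | q x != q y].
Proof.
rewrite inE; apply/existsP/idP => [[a /existsP [b /and3P[ab h /eqP e]]]|/andP[xy h]]; last first.
  by exists x; apply/existsP; exists y; rewrite xy h eqxx.
have [[-> ->]|[-> ->]] := set2_eq e; first by rewrite ab h.
by rewrite eq_sym ab (eq_sym (q b)) orbCA h.
Qed.

Lemma joinedP B q e : e \in joined B q ->
  exists x y, [/\ x != y, [|| x \in B, y \in B | q x != q y] & e = [set x; y]].
Proof.
rewrite inE => /existsP[x /existsP[y /and3P[xy h /eqP e']]]; by exists x, y.
Qed.

Lemma joined_graph B q : is_graph (joined B q).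
Proof.
by apply/forall_inP => e /joinedP [x [y [xy _ ->]]]; rewrite cards2 xy.
Qed.

End Joined.

(** Used to rename colours so that a chosen edge of [H] receives prescribed colours. The first
    transposition takes [i] to [k]; the second takes the image of [j] to [l] and fixes [k]. *)
Lemma exists_inj_map2 r (i j k l : 'I_r) : i != j -> k != l ->
  exists f : 'I_r -> 'I_r, [/\ injective f, f i = k & f j = l].
Proof.
move=> ij kl.
exists (fun x => tperm (tperm i k j) l (tperm i k x)); split.
- by move=> x y /= /perm_inj /perm_inj.
- rewrite tpermL tpermD //; last by rewrite eq_sym.
  by rewrite -[X in _ != X](tpermL i k) (inj_eq perm_inj) eq_sym.
- by rewrite tpermL.
Qed.

(** * Embeddings gained by adding the missing edges *)

Section Gain.
Variables (VH V : finType) (EH : {set {set VH}}) (r : nat).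
Variables (B : {set V}) (q : V -> 'I_r) (a : nat).

(** Fix an edge of [H]. For each missing edge there are at least [a ^ (#|VH| - 2)] embeddings that
    send the fixed edge to it; these are new, and different missing edges give different
    embeddings. *)
Lemma embs_gain (E : {set {set V}}) : is_graph EH -> EH != set0 ->
  colorable_on setT EH r -> 1 < r ->
  (forall i, #|VH| * a + #|B| + 2 <= #|[set x | q x == i]|) ->
  E \subset joined B q ->
  #|embs EH E| + #|joined B q :\: E| * a ^ (#|VH| - 2) <= #|embs EH (joined B q)|.
Proof.
move=> gH /set0Pn [d dH] /colorable_onP [c hc] r1 hq ET.
have [u [v [uv duv]]] := graph_edgeP gH dH.
have cuv : c u != c v by apply: hc; rewrite ?inE // -duv.
set T := joined B q; set M := T :\: E.
pose Z := [set f in embs EH T | f @: d \in M].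
have dis : [disjoint embs EH E & Z].
  rewrite disjoints_subset; apply/subsetP => f; rewrite !inE => /andP[_ /forall_inP fE].
  by rewrite fE // !andbF.
have sub : embs EH E :|: Z \subset embs EH T.
  rewrite subUset; apply/andP; split; last by apply/subsetP => f; rewrite inE => /andP[].
  apply/subsetP => f; rewrite !inE => /andP[-> /forall_inP fE] /=.
  by apply/forall_inP => e eH; apply: (subsetP ET); exact: fE.
apply: leq_trans (subset_leq_card sub); rewrite cardsU disjoint_setI0 // cards0 subn0.
rewrite leq_add2l.
rewrite -[#|Z|]sum1_card (partition_big (fun f : {ffun VH -> V} => f @: d) (mem M)) /=; last first.
  by move=> f; rewrite inE => /andP[].
rewrite -sum_nat_const; apply: leq_sum => e eM.
have : e \in T by move: eM; rewrite inE => /andP[].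
case/joinedP => x [y [xy hxy exy]].
(* A vertex of [B] is adjacent to everything, so it may stand in for a vertex of any class. *)
have [i [j [ij hx hy]]] : exists i j, [/\ i != j, (x \in B) || (q x == i) & (y \in B) || (q y == j)].
  have other k : exists l : 'I_r, l != k.
    have r0 : 0 < r by exact: ltnW.
    case: (eqVneq k (Ordinal r0)) => [->|kr]; last by exists (Ordinal r0); rewrite eq_sym.
    by exists (Ordinal r1).
  case/or3P: hxy => [xB|yB|qxy].
  - by have [l lk] := other (q y); exists l, (q y); rewrite xB eqxx orbT.
  - by have [l lk] := other (q x); exists (q x), l; rewrite yB eqxx orbT eq_sym.
  - by exists (q x), (q y); rewrite !eqxx !orbT.
have [pi [pii piu piv]] := exists_inj_map2 cuv ij.
(* The other vertices of [H] range freely over disjoint [a]-sets in the classes of their renamed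
   colours, away from [B], [x] and [y]; disjointness makes the maps injective. *)
have [|Bl [hBl dBl]] := @disjoint_subsets VH V
   (fun w => [set z | q z == pi (c w)] :\: (B :|: [set x; y])) a.
  move=> w; rewrite cardsD.
  have := hq (pi (c w)); set Q := [set z | _].
  have : #|Q :&: (B :|: [set x; y])| <= #|B| + 2.
    apply: leq_trans (subset_leq_card (subsetIr _ _)) _.
    have [+ _] := leq_card_setU B [set x; y].
    by rewrite cards2 xy.
  by move: #|Q| #|B| #|_ :&: _| (#|VH| * a); clear; lia.
pose F w := if w == u then [set x] else if w == v then [set y] else Bl w.
have cF : #|[set f : {ffun VH -> V} | [forall w, f w \in F w]]| = a ^ (#|VH| - 2).
  rewrite card_family_ffun (bigD1 u) // (bigD1 v) /=; last by rewrite eq_sym.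
  rewrite /F !eqxx eq_sym (negbTE uv) !cards1 !mul1n.
  rewrite (eq_bigr (fun=> a)); last first.
    by move=> w /andP[/negbTE-> /negbTE->]; have [] := hBl w.
  rewrite prod_nat_const; congr (_ ^ _).
  have -> : #|[pred w | (w != u) && (w != v)]| = #|~: [set u; v]|.
    by apply: eq_card => w; rewrite !inE negb_or.
  by rewrite -(cardsC [set u; v]) cards2 uv addKn.
rewrite -cF sum1_card; apply: subset_leq_card; apply/subsetP => f.
rewrite inE => /forallP fF.
have fu : f u = x by have := fF u; rewrite /F eqxx inE => /eqP.
have fv : f v = y by have := fF v; rewrite /F eqxx eq_sym (negbTE uv) inE => /eqP.
have fw w : w != u -> w != v ->
    [/\ f w \in Bl w, q (f w) = pi (c w), f w \notin B, f w != x & f w != y].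
  move=> wu wv; have := fF w; rewrite /F (negbTE wu) (negbTE wv) => fB.
  have [sB _] := hBl w; have := subsetP sB _ fB.
  by rewrite !inE !negb_or => /andP[/andP[-> /andP[-> ->]] /eqP].
have key w : (f w \in B) || (q (f w) == pi (c w)).
  case: (eqVneq w u) => [->|wu]; first by rewrite fu piu.
  case: (eqVneq w v) => [->|wv]; first by rewrite fv piv.
  by have [_ -> _ _ _] := fw w wu wv; rewrite eqxx orbT.
have fi : injective f.
  move=> w w' ww'; apply/eqP/negP => /negP neq.
  case: (eqVneq w u) neq ww' => [->|wu]; [|case: (eqVneq w v) => [->|wv]];
  (case: (eqVneq w' u) => [->|wu']; [|case: (eqVneq w' v) => [->|wv']]);
   rewrite ?fu ?fv ?eqxx // => neq.
  - by move=> h; rewrite h eqxx in xy.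
  - by have [_ _ _ + _] := fw w' wu' wv' => /[swap] <-; rewrite eqxx.
  - by move=> h; rewrite h eqxx in xy.
  - by have [_ _ _ _ +] := fw w' wu' wv' => /[swap] <-; rewrite eqxx.
  - by have [_ _ _ + _] := fw w wu wv => /[swap] ->; rewrite eqxx.
  - by have [_ _ _ _ +] := fw w wu wv => /[swap] ->; rewrite eqxx.
  - move=> h; have [h1 _ _ _ _] := fw w wu wv; have [h2 _ _ _ _] := fw w' wu' wv'.
    by move: (dBl _ _ neq); rewrite disjoints_subset => /subsetP /(_ _ h1); rewrite inE h h2.
rewrite unfold_in /= inE; apply/andP; split; last by rewrite duv imset_pair fu fv exy.
rewrite duv imset_pair fu fv -exy eM andbT; apply/embsP => //; split=> // w w' ww'.
have cw : c w != c w' by apply: hc.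
rewrite in_joined (inj_eq fi) (graph_edge_neq gH ww') /=.
case/orP: (key w) => [->//|/eqP qw]; case/orP: (key w') => [->|/eqP qw']; first by rewrite orbT.
by rewrite qw qw' (inj_eq pii) cw !orbT.
Qed.

End Gain.

(** * Embedding the forbidden graph *)

Section Greedy.
Variables (VF V : finType) (EF : {set {set VF}}) (G : {set {set V}}) (r : nat).
Variable (p : V -> 'I_r).

Definition missing (v : V) := [set z | [set v; z] \in joined set0 p :\: G].

Definition candidates (S : {set VF}) (f0 : VF -> V) (x : VF) (i : 'I_r) :=
  [set z | (p z == i) &&
     [forall y in S, ([set x; y] \in EF) ==> ([set f0 y; z] \in G)]].

(** The vertices outside [S] are placed one by one in the classes given by [c]. The constraints from
    [S] are built into [candidates]; a vertex placed earlier outside [A] rules out at most [M] more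
    choices, since adjacent vertices outside [S] go to different classes. *)
Lemma greedy_embedding (S : {set VF}) (f0 : VF -> V) (c : VF -> 'I_r)
    (A : {set V}) (M : nat) : is_graph EF ->
  {in S &, injective f0} ->
  {in S &, forall x y, [set x; y] \in EF -> [set f0 x; f0 y] \in G} ->
  (forall x y, x \notin S -> y \notin S -> [set x; y] \in EF -> c x != c y) ->
  (forall v, v \notin A -> #|missing v| <= M) ->
  (forall x, x \notin S ->
     #|A| + #|VF| + #|VF| * M < #|candidates S f0 x (c x)|) ->
  embs EF G != set0.
Proof.
move=> gF f0i f0E hc hA hcand.
pose P (l : seq VF) x := (x \in S) || (x \in l).
have [f [fi fE _ _]] : exists f : VF -> V,
   [/\ forall x y, P (enum (~: S)) x -> P (enum (~: S)) y -> f x = f y -> x = y,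
       forall x y, P (enum (~: S)) x -> P (enum (~: S)) y ->
         [set x; y] \in EF -> [set f x; f y] \in G,
       {in S, f =1 f0} &
       {in enum (~: S), forall x, p (f x) = c x /\ f x \notin A}]; last first.
  have PT x : P (enum (~: S)) x by rewrite /P mem_enum inE orbN.
  apply/set0Pn; exists (finfun f); apply/embsP => //; split.
    by move=> x y; rewrite !ffunE; exact: fi.
  by move=> x y xy; rewrite !ffunE; exact: fE.
have : all (mem (~: S)) (enum (~: S)) by apply/allP => x; rewrite mem_enum.
have := enum_uniq (~: S); elim: (enum (~: S)) => [_ _|x l IH] /=.
  exists f0; split=> //.
    by move=> x y; rewrite /P !in_nil !orbF; exact: f0i.
  by move=> x y; rewrite /P !in_nil !orbF; exact: f0E.
move=> /andP[xl ul] /andP[xS lS]; rewrite inE in xS.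
have [f [fi fE fS fl]] := IH ul lS.
(* The choices to avoid for [x]: the bad vertices, the images already in use, and the vertices that
   an earlier image fails to see. *)
pose W := A :|: [set f y | y : VF] :|: \bigcup_(y in l) missing (f y).
have cW : #|W| <= #|A| + #|VF| + #|VF| * M.
  rewrite /W; have [h _] := leq_card_setU (A :|: [set f y | y : VF]) (\bigcup_(y in l) missing (f y)).
  apply: leq_trans h _; apply: leq_add.
    have [h _] := leq_card_setU A [set f y | y : VF].
    by apply: leq_trans h _; rewrite leq_add2l; exact: leq_imset_card.
  apply: leq_trans (leq_card_bigcup _ _) _.
  apply: (leq_trans (n := \sum_(y in l) M)).
    by apply: leq_sum => y yl; apply: hA; have [] := fl y yl.
  by rewrite sum_nat_const leq_mul2r max_card orbT.
have [v vC vW] : exists2 v, v \in candidates S f0 x (c x) & v \notin W.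
  apply/subsetPn; apply/negP => /subset_leq_card.
  by rewrite leqNgt (leq_ltn_trans cW) // hcand.
move: vC; rewrite inE => /andP[/eqP pv /forall_inP vE].
move: vW; rewrite !inE !negb_or => /andP[/andP[vA vf] vl].
have vf' y : f y != v.
  by apply: contra vf => /eqP <-; apply/imsetP; exists y.
have nS y : y \in S -> (y == x) = false by move=> yS; apply: contraNF xS => /eqP <-.
have nl y : y \in l -> (y == x) = false by move=> yl; apply: contraNF xl => /eqP <-.
have nP y : P l y -> (y == x) = false by case/orP; [exact: nS | exact: nl].
have PE y : P (x :: l) y = (y == x) || P l y by rewrite /P inE orbCA.
have key y : P l y -> [set x; y] \in EF -> [set f y; v] \in G.
  case/orP => [yS xy|yl xy].
    by rewrite fS //; exact: implyP (vE y yS) xy.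
  have [pf _] := fl y yl.
  have : v \notin missing (f y) by apply: contra vl => h; apply/bigcupP; exists y.
  have yS : y \notin S by move/allP: lS => /(_ y yl) /=; rewrite inE.
  rewrite inE inE negb_and negbK in_joined !inE /= vf' /= pf pv eq_sym (hc x y) ?orbF //.
exists (fun y => if y == x then v else f y); split.
- move=> y z; rewrite !PE.
  case: (eqVneq y x) => [->|_] /=; case: (eqVneq z x) => [->|_] //=.
  + by move=> _ _ h; have := vf' z; rewrite h eqxx.
  + by move=> _ _ h; have := vf' y; rewrite h eqxx.
  + exact: fi.
- move=> y z; rewrite !PE.
  case: (eqVneq y x) => [->|_] /=; case: (eqVneq z x) => [->|_] //=.
  + by move=> _ _ h; have := graph_edge_neq gF h; rewrite eqxx.
  + by move=> _ zP xz; rewrite setUC key.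
  + by move=> yP _ yx; rewrite key // setUC.
  + exact: fE.
- by move=> y yS; rewrite nS // fS.
- move=> y; rewrite inE; case: (eqVneq y x) => [->|_] //= yl; exact: fl.
Qed.

End Greedy.

(** * Embedding component by component *)

Section Gadgets.
Variables (VF V : finType) (EF : {set {set VF}}) (G : {set {set V}}) (r m : nat).
Variable (p : V -> 'I_r).
Hypothesis gF : is_graph EF.

(* The part [S] of the component [C] is placed on [g]; the rest is
   [r]-coloured, with at least [m] suitable images in [V] for every vertex. *)
Definition gadget (C : {set VF}) (g : {set V}) : Prop :=
  exists (S : {set VF}) (f0 : VF -> V) (c : VF -> 'I_r),
  [/\ {in S, forall x, f0 x \in g},
      {in S &, injective f0} /\
      {in S &, forall x y, [set x; y] \in EF -> [set f0 x; f0 y] \in G},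
      {in C &, forall x y, x \notin S -> y \notin S -> [set x; y] \in EF -> c x != c y} &
      {in C, forall x, x \notin S -> m <= #|candidates EF G p S f0 x (c x)|}].

Lemma gadget_set0 (C : {set VF}) : (forall i, m <= #|[set z | p z == i]|) -> 0 < #|V| ->
  colorable_on C EF r -> gadget C set0.
Proof.
move=> hm /card_gt0P[v0 _] /colorable_onP [c hc].
exists set0, (fun=> v0), c; split.
- by move=> x; rewrite inE.
- by split=> x y; rewrite inE.
- by move=> x y xC yC _ _; exact: hc.
- move=> x xC _; apply: leq_trans (hm (c x)) _; apply: subset_leq_card.
  apply/subsetP => z; rewrite !inE => ->; apply/forall_inP => y; by rewrite inE.
Qed.

(** One end of the critical edge is placed on [b]. The colouring of [C] without that edge is proper
    on the remaining vertices, and [b] has enough neighbours in every class for the neighbours of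
    that end. *)
Lemma gadget_set1 (C : {set VF}) (b : V) e : is_graph G ->
  e \in EF -> colorable_on C (EF :\ e) r ->
  (forall i, m <= #|[set z | (p z == i) && ([set b; z] \in G)]|) ->
  gadget C [set b].
Proof.
move=> gG eF /colorable_onP [c hc] hm.
have [u [v [uv euv]]] := graph_edgeP gF eF.
exists [set u], (fun=> b), c; split.
- by move=> x; rewrite !inE.
- split=> x y; rewrite !inE => /eqP -> /eqP ->//.
  by move=> h; have := graph_edge_neq gF h; rewrite eqxx.
- move=> x y xC yC; rewrite !inE => xu yu xy; apply: hc => //.
  rewrite 2!inE xy andbT euv; apply/negP => /eqP /set2_eq [] [] ? ?; subst.
    by rewrite eqxx in xu.
  by rewrite eqxx in yu.
- move=> x xC _; apply: leq_trans (hm (c x)) _; apply: subset_leq_card.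
  apply/subsetP => z; rewrite !inE => /andP[-> bz].
  by apply/forall_inP => y _; apply/implyP.
Qed.

(** The critical edge is placed on [[set x; y]]. Its ends share a colour, renamed [j], so the
    remaining vertices of colour [j] are not adjacent to them; only the other colours need common
    neighbours of [x] and [y]. *)
Lemma gadget_set2 (C : {set VF}) (x y : V) e (j : 'I_r) : is_graph G ->
  e \in EF -> e \subset C -> ~~ colorable_on C EF r -> colorable_on C (EF :\ e) r ->
  [set x; y] \in G -> m <= #|[set z | p z == j]| ->
  (forall i, i != j ->
    m <= #|[set z | [&& p z == i, [set x; z] \in G & [set y; z] \in G]]|) ->
  gadget C [set x; y].
Proof.
move=> gG eF eC nC /colorable_onP [c0 hc0] xyG hj hi.
have [u [v [uv euv]]] := graph_edgeP gF eF.
have uC : u \in C by apply: (subsetP eC); rewrite euv set21.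
have vC : v \in C by apply: (subsetP eC); rewrite euv set22.
(* Otherwise [c0] would properly colour [C] with the edge [e] restored. *)
have c0uv : c0 u = c0 v.
  apply/eqP; apply: contraNT nC => c0uv; apply/colorable_onP; exists c0.
  move=> w w' wC w'C ww'; case: (eqVneq [set w; w'] e) => [|ne]; last first.
    by apply: hc0 => //; rewrite 2!inE ne.
  by rewrite euv => /set2_eq [] [-> ->] //; rewrite eq_sym.
pose c w := tperm (c0 u) j (c0 w).
have cu : c u = j by rewrite /c tpermL.
have cv : c v = j by rewrite /c -c0uv tpermL.
have hc : {in C &, forall w w', [set w; w'] \in EF :\ e -> c w != c w'}.
  by move=> w w' wC w'C ww'; rewrite (inj_eq perm_inj); exact: hc0.
have vu : (v == u) = false by rewrite eq_sym; exact: negbTE.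
exists [set u; v], (fun w => if w == u then x else y), c; split.
- by move=> w; rewrite !inE => /orP[] /eqP ->; rewrite ?eqxx ?vu ?eqxx ?orbT.
- have xy := graph_edge_neq gG xyG.
  split=> w w'; rewrite !inE => /orP[] /eqP -> /orP[] /eqP ->; rewrite ?eqxx ?vu //.
  + by move=> h; rewrite h eqxx in xy.
  + by move=> h; rewrite h eqxx in xy.
  + by move=> h; have := graph_edge_neq gF h; rewrite eqxx.
  + by move=> _; rewrite setUC.
  + by move=> h; have := graph_edge_neq gF h; rewrite eqxx.
- move=> w w' wC w'C wS w'S ww'; apply: hc => //.
  rewrite 2!inE ww' andbT euv; apply: contra wS => /eqP <-; exact: set21.
- move=> w wC wS; case: (eqVneq (c w) j) => [cw|cw].
    rewrite cw; apply: leq_trans hj _; apply: subset_leq_card.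
    apply/subsetP => z; rewrite !inE => ->; apply/forall_inP => w'.
    rewrite !inE => w'uv; apply/implyP => ww'.
    have : c w != c w'.
      apply: hc => //; first by case/orP: w'uv => /eqP ->.
      rewrite 2!inE ww' andbT euv; apply: contra wS => /eqP <-; exact: set21.
    by rewrite cw; case/orP: w'uv => /eqP ->; rewrite ?cu ?cv eqxx.
  apply: leq_trans (hi _ cw) _; apply: subset_leq_card.
  apply/subsetP => z; rewrite !inE => /and3P[-> xz yz].
  by apply/forall_inP => w' _; apply/implyP => _; case: ifP.
Qed.

(** No edge joins two components, so the gadgets glue to one partial embedding, injective because
    the sets [g C] are disjoint; the greedy embedding does the rest. *)
Lemma gadgets_embed (g : {set VF} -> {set V}) (A : {set V}) (M : nat) : 0 < #|V| ->
  {in comps EF, forall C, gadget C (g C)} ->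
  {in comps EF &, forall C D, C != D -> [disjoint g C & g D]} ->
  (forall v, v \notin A -> #|missing G p v| <= M) ->
  #|A| + #|VF| + #|VF| * M < m ->
  embs EF G != set0.
Proof.
move=> V0 hg dg hA hm.
have /card_gt0P[v0 _] := V0.
pose good (C : {set VF}) (u : {set VF} * (VF -> V) * (VF -> 'I_r)) :=
  C \in comps EF ->
  [/\ {in u.1.1, forall x, u.1.2 x \in g C},
      {in u.1.1 &, injective u.1.2} /\
      {in u.1.1 &, forall x y, [set x; y] \in EF -> [set u.1.2 x; u.1.2 y] \in G},
      {in C &, forall x y, x \notin u.1.1 -> y \notin u.1.1 -> [set x; y] \in EF -> u.2 x != u.2 y} &
      {in C, forall x, x \notin u.1.1 -> m <= #|candidates EF G p u.1.1 u.1.2 x (u.2 x)|}].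
(* The data are chosen for all vertex sets at once; a set that is not a component gets a dummy
   value. *)
have [u hu] : exists u, forall C, good C (u C).
  apply: fin_all_exists => C; case: (boolP (C \in comps EF)) => hC.
    by have [S [f0 [c h]]] := hg C hC; exists (S, f0, c).
  by exists (set0, fun=> v0, fun=> p v0) => h; rewrite h in hC.
pose K x := component EF x.
pose S := [set x | x \in (u (K x)).1.1].
pose f0 x := (u (K x)).1.2 x.
pose c x := (u (K x)).2 x.
have huK x := hu (K x) (component_in_comps EF x).
apply: (@greedy_embedding _ _ _ _ _ p S f0 c A M) => //.
- move=> x y; rewrite !inE => xS yS f0xy.
  case: (eqVneq (K x) (K y)) => [Kxy|Kxy].
    have [_ [fi _] _ _] := huK y.
    by apply: fi => //; [rewrite -Kxy | rewrite -[in LHS]Kxy].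
  have [hx _ _ _] := huK x; have [hy _ _ _] := huK y.
  have := dg _ _ (component_in_comps EF x) (component_in_comps EF y) Kxy.
  rewrite disjoints_subset => /subsetP /(_ _ (hx x xS)); rewrite inE -/(f0 x) f0xy.
  by rewrite hy.
- move=> x y; rewrite !inE => xS yS xy; have Kxy : K x = K y := edge_component xy.
  have [_ [_ fE] _ _] := huK y.
  by rewrite /f0 Kxy; apply: fE => //; rewrite -Kxy.
- move=> x y; rewrite !inE => xS yS xy; have Kxy : K x = K y := edge_component xy.
  have [_ _ hc _] := huK y; rewrite /c Kxy; rewrite Kxy in xS.
  by apply: hc => //; [rewrite -Kxy|]; exact: mem_component.
- move=> x; rewrite inE => xS; apply: leq_trans hm _.
  have [_ _ _ hc] := huK x; apply: leq_trans (hc x (mem_component EF x) xS) _.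
  apply: subset_leq_card; apply/subsetP => z; rewrite !inE => /andP[-> /forall_inP h].
  apply/forall_inP => y; rewrite inE => yS; apply/implyP => xy.
  have Kxy : K x = K y := edge_component xy.
  by rewrite /f0 -Kxy; apply: (implyP (h y _)) => //; rewrite Kxy.
Qed.

End Gadgets.

(** * Components of the forbidden graph, and stability *)

Lemma embs_sub (VH V : finType) (EH : {set {set VH}}) (E1 E2 : {set {set V}}) :
  E1 \subset E2 -> embs EH E1 \subset embs EH E2.
Proof.
move=> sE; apply/subsetP => f; rewrite !inE => /andP[-> /forall_inP h] /=.
by apply/forall_inP => e eH; apply: (subsetP sE); exact: h.
Qed.

Section Forbidden.
Variables (VF : finType) (EF : {set {set VF}}) (r s : nat).
Hypothesis gF : is_graph EF.

Definition critical_comps := [set C in comps EF | chi_on C EF == r.+1].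

Hypothesis chi_comps : forall C, C \in comps EF -> chi_on C EF <= r.+1.
Hypothesis card_critical : #|critical_comps| = s.
Hypothesis comps_critical : forall C, C \in comps EF -> chi_on C EF = r.+1 ->
  exists e, color_critical_edge C EF e.

Lemma critical_not_colorable C : C \in critical_comps -> ~~ colorable_on C EF r.
Proof. by rewrite inE => /andP[_ /eqP h]; rewrite -chi_on_leP // h ltnn. Qed.

Lemma critical_edge C : C \in critical_comps ->
  exists e, [/\ e \in EF, e \subset C & colorable_on C (EF :\ e) r].
Proof.
rewrite inE => /andP[hC /eqP h]; have [e /and3P[eF eC]] := comps_critical hC h.
rewrite h ltnS chi_on_leP => [?|]; first by exists e.
apply/forall_inP => d; rewrite inE => /andP[_ dF].
by move/forall_inP: gF; apply.
Qed.

Lemma noncritical_colorable C :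
  C \in comps EF -> C \notin critical_comps -> colorable_on C EF r.
Proof.
move=> hC; rewrite inE hC /= => ne.
by rewrite -chi_on_leP // -ltnS ltn_neqAle ne chi_comps.
Qed.

(** Colourings of the components combine to one of [F], and a critical component needs all the
    colours. Hence stability speaks of [r]-partite graphs. *)
Lemma chi_forbidden : 0 < s -> chi EF = r.+1.
Proof.
move=> s0; apply/eqP; rewrite eqn_leq; apply/andP; split; last first.
  rewrite ltnNge /chi chi_on_leP //; apply/negP => /colorable_onP [c hc].
  have /card_gt0P[C hC] : 0 < #|critical_comps| by rewrite card_critical.
  move/negP: (critical_not_colorable hC); apply; apply/colorable_onP.
  by exists c => x y _ _; apply: hc; rewrite inE.
rewrite /chi chi_on_leP //.
pose good (C : {set VF}) (c : VF -> 'I_r.+1) := C \in comps EF ->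
  {in C &, forall x y, [set x; y] \in EF -> c x != c y}.
have [c hc] : exists c, forall C, good C (c C).
  apply: fin_all_exists => C; case: (boolP (C \in comps EF)) => hC.
    by have /[!chi_on_leP] // := chi_comps hC; case/colorable_onP => c hc; exists c.
  by exists (fun=> ord0) => h; rewrite h in hC.
apply/colorable_onP; exists (fun x => c (component EF x) x) => x y _ _ xy.
have Kxy := edge_component xy; rewrite Kxy.
by apply: (hc _ (component_in_comps EF y)) => //; [rewrite -Kxy|]; exact: mem_component.
Qed.

(* Outside [B] the graph is [k]-partite, so each of the [s] critical components
   needs a vertex of [B] of its own. *)
Lemma joined_free (V : finType) k (B : {set V}) (q : V -> 'I_k) :
  k <= r -> #|B| < s -> embs EF (joined B q) = set0.
Proof.
move=> kr Bs; apply/eqP/set0Pn => -[f /embsP] /(_ gF) [fi fE].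
have : critical_comps \subset component EF @: [set x | f x \in B].
  apply/subsetP => C hC; have hC' : C \in comps EF by move: hC; rewrite inE => /andP[].
  have [x xC fxB] : exists2 x, x \in C & f x \in B.
    apply/exists_inP; apply: contraT => /exists_inPn h.
    case/negP: (critical_not_colorable hC); apply: colorable_on_leq kr _.
    apply/colorable_onP.
    exists (q \o f) => x y xC yC /fE; rewrite in_joined => /andP[_].
    by rewrite (negbTE (h x xC)) (negbTE (h y yC)).
  by apply/imsetP; exists x; [rewrite inE | exact: comps_component].
move/subset_leq_card; rewrite card_critical leqNgt => /negP; apply.
apply: leq_ltn_trans (leq_imset_card _ _) _.
apply: leq_ltn_trans Bs; rewrite -(card_imset _ fi); apply: subset_leq_card.
by apply/subsetP => _ /imsetP[x + ->]; rewrite inE.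
Qed.

(** The critical components receive distinct members of [S], by their position in an enumeration;
    the other components receive the empty gadget. *)
Lemma gadgets_force (V : finType) (G : {set {set V}}) (p : V -> 'I_r) (m : nat)
    (S : {set {set V}}) (A : {set V}) (M : nat) :
  s <= #|S| -> 0 < #|V| -> {in S &, forall g g' : {set V}, g != g' -> [disjoint g & g']} ->
  {in S, forall g, {in critical_comps, forall C, gadget EF G m p C g}} ->
  (forall i, m <= #|[set z | p z == i]|) ->
  (forall v, v \notin A -> #|missing G p v| <= M) ->
  #|A| + #|VF| + #|VF| * M < m ->
  embs EF G != set0.
Proof.
move=> hS V0 dS gS hp hA hm.
pose idx C := index C (enum critical_comps).
pose g C := if C \in critical_comps then nth set0 (enum S) (idx C) else set0.
have idx_lt C : C \in critical_comps -> idx C < size (enum S).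
  move=> hC; rewrite -cardE; apply: leq_trans hS.
  by rewrite -card_critical cardE index_mem mem_enum.
have gC C : C \in critical_comps -> g C \in S.
  by move=> hC; rewrite /g hC -mem_enum mem_nth // idx_lt.
apply: (@gadgets_embed _ _ EF G r m p gF g A M) => //.
- move=> C hC; case: (boolP (C \in critical_comps)) => hC'.
    by apply: gS => //; exact: gC.
  rewrite /g (negbTE hC'); apply: gadget_set0 => //; exact: noncritical_colorable.
- move=> C C' _ _ CC'.
  case: (boolP (C \in critical_comps)) => hC; last first.
    by rewrite /g (negbTE hC) disjoints_subset sub0set.
  case: (boolP (C' \in critical_comps)) => hC'; last first.
    by rewrite disjoint_sym /g (negbTE hC') disjoints_subset sub0set.
  apply: dS; rewrite ?gC // /g hC hC' nth_uniq ?idx_lt ?enum_uniq //.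
  apply: contra CC' => /eqP h; apply/eqP.
  by rewrite -(nth_index C (s := enum critical_comps) (x := C)) ?mem_enum // -/(idx C) h nth_index ?mem_enum.
Qed.

End Forbidden.

(** * Stability in terms of embeddings *)

Section Stability.
Variables (VF VH : finType) (EF : {set {set VF}}) (EH : {set {set VH}}) (r : nat).

Definition emb_free_graph n (G : {set {set 'I_n}}) := is_graph G && (embs EF G == set0).

Lemma ex_max n (G : {set {set 'I_n}}) : emb_free_graph G ->
  #|embs EH G| <= #|embs EH EH| * ex n EH EF.
Proof.
move=> /andP[gG fG]; rewrite embs_subcount leq_mul2l; apply/orP; right.
by apply: leq_bigmax_cond; rewrite gG subcount_eq0.
Qed.

(** Since [F] has an edge, the empty graph is [F]-free, so the maximum is over a nonempty family and
    is attained. *)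
Lemma ex_witness n : EF != set0 ->
  exists2 G : {set {set 'I_n}}, emb_free_graph G & subcount EH G = ex n EH EF.
Proof.
move=> /set0Pn [e eF].
have h0 : is_graph (set0 : {set {set 'I_n}}) && (subcount EF (set0 : {set {set 'I_n}}) == 0).
  rewrite subcount_eq0; apply/andP; split; first by apply/forall_inP => d; rewrite inE.
  apply/eqP/setP => f; rewrite !inE; apply/negP => /andP[_ /forall_inP /(_ e eF)].
  by rewrite inE.
have [|G /andP[gG fG] eG] := @eq_bigmax_cond _
    [pred E : {set {set 'I_n}} | is_graph E && (subcount EF E == 0)] (fun E => subcount EH E).
  by apply/card_gt0P; exists set0; rewrite inE.
by exists G; rewrite // /emb_free_graph gG -subcount_eq0.
Qed.

Definition emb_stable := forall K, 0 < K -> exists D n0, 0 < D /\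
  forall n, n0 <= n -> forall G : {set {set 'I_n}}, emb_free_graph G ->
    (forall G' : {set {set 'I_n}}, emb_free_graph G' ->
       D * #|embs EH G'| <= D * #|embs EH G| + n ^ #|VH|) ->
    exists q : 'I_n -> 'I_r, K * edit_dist G (joined set0 q) <= n ^ 2.

Lemma complete_partite_joined (V : finType) k (T : {set {set V}}) :
  complete_partite k T -> exists q : V -> 'I_k, T = joined set0 q.
Proof.
move=> /existsP [p /andP[_ /eqP ->]]; exists p; apply/setP => e; rewrite !inE.
apply: eq_existsb => x; apply: eq_existsb => y; rewrite !inE /=.
by case: (eqVneq x y) => [->|]; rewrite ?eqxx.
Qed.

Lemma weakly_turan_stable_emb : EF != set0 -> chi EF = r.+1 ->
  weakly_turan_stable EH EF -> emb_stable.
Proof.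
move=> F0 chiF st K K0.
have [|delta [d0 [n0 hn]]] := st (K%:R^-1)%R.
  by rewrite Num.Theory.invr_gt0 Num.Theory.ltr0n.
(* A natural number above [1 / delta], so that [n ^ #|VH| / D] is within the permitted deficit. *)
exists (Num.bound (delta^-1)%R), n0.
have hD : (delta^-1 < (Num.bound (delta^-1)%R)%:R)%R.
  by apply: Num.Theory.archi_boundP; rewrite Num.Theory.invr_ge0 Order.POrderTheory.ltW.
set D := Num.bound _ in hD *.
have D0 : 0 < D.
  rewrite -(Num.Theory.ltr0n rat); apply: Order.POrderTheory.lt_trans hD.
  by rewrite Num.Theory.invr_gt0.
split=> // n n_n0 G fG hG; have /andP[gG /eqP eG] := fG.
have [||T [cT eT]] := hn n n_n0 G gG.
- by apply/eqP; rewrite subcount_eq0 eG.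
- have [G' fG' eG'] := ex_witness n F0.
  have := hG G' fG'; rewrite (embs_subcount EH G) (embs_subcount EH G') eG'; set a := #|embs EH EH| => h.
  (* Embeddings are copies times [a]; as [a] is positive, the error term may be multiplied by [a]
     before [a] is cancelled. *)
  have {}h : D * ex n EH EF <= D * subcount EH G + n ^ #|VH|.
    have a0 : 0 < a := aut_gt0 EH.
    rewrite -(leq_pmul2l a0); move: h; rewrite mulnDr !(mulnCA a) => h.
    by apply: leq_trans h _; rewrite leq_add2l leq_pmull.
  move: h; rewrite -(Num.Theory.ler_nat rat) GRing.natrD !GRing.natrM GRing.natrX => h.
  have D0' : (0 < D%:R :> rat)%R by rewrite Num.Theory.ltr0n.
  rewrite -(Num.Theory.ler_pM2l D0').
  have hd : (1 <= D%:R * delta)%R.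
    apply: Order.POrderTheory.ltW; move: hD.
    by rewrite -Num.Theory.ltr_pdivrMr // GRing.div1r.
  have hx : (0 <= n%:R ^+ #|VH| :> rat)%R by apply: Num.Theory.exprn_ge0; rewrite Num.Theory.ler0n.
  move: h hd hx; move: (n%:R ^+ #|VH|)%R (ex n EH EF)%:R%R (subcount EH G)%:R%R D%:R%R.
  move=> X e c D' h hd hx.
  rewrite GRing.mulrBr Num.Theory.lerBlDr; apply: Order.POrderTheory.le_trans h _.
  by rewrite Num.Theory.lerD2l GRing.mulrA Num.Theory.ler_peMl.
rewrite chiF in cT; have [q qT] := complete_partite_joined cT; exists q.
rewrite -qT -(Num.Theory.ler_nat rat) GRing.natrM GRing.natrX.
by move: eT; rewrite Num.Theory.ler_pdivlMl // Num.Theory.ltr0n.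
Qed.
End Stability.

Lemma large_class (V : finType) r (q : V -> 'I_r) : 0 < r ->
  exists i, #|V| <= r * #|[set x | q x == i]|.
Proof.
move=> r0.
suff /existsP : [exists i, #|V| <= r * #|[set x | q x == i]|] by [].
apply: contraT => /existsPn h.
have : \sum_(i < r) #|[set x | q x == i]| = #|V|.
  rewrite -sum1_card (partition_big q predT) //=; apply: eq_bigr => i _.
  by rewrite sum1dep_card.
move=> e.
have : \sum_(i < r) (r * #|[set x | q x == i]| + 1) <= \sum_(i < r) #|V|.
  by apply: leq_sum => i _; rewrite addn1 ltnNge h.
rewrite big_split /= -big_distrr /= e !sum_nat_const card_ord muln1.
by rewrite -{2}[r * _]addn0 leq_add2l leqNgt r0.
Qed.

(* The obstruction is an edge together with a vertex adjacent to neither end: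
   complete multipartite graphs contain none, while here there are [a ^ 3]. *)
Lemma edit_dist_obstruction (V : finType) r (Q : {set {set V}}) (q : V -> 'I_r)
    (X : 'I_3 -> {set V}) a :
  (forall i, #|X i| = a) ->
  (forall i j, i != j -> [disjoint X i & X j]) ->
  {in X (inord 0) & X (inord 1), forall x y, [set x; y] \in Q} ->
  {in X (inord 0) & X (inord 2), forall x z, [set x; z] \notin Q} ->
  {in X (inord 1) & X (inord 2), forall y z, [set y; z] \notin Q} ->
  a ^ 3 <= 6 * (edit_dist Q (joined set0 q) * #|V|).
Proof.
move=> cX dX h01 h02 h12; set T := joined set0 q.
set D := (Q :\: T) :|: (T :\: Q).
pose P := [set w : V * V | [set w.1; w.2] \in D].
have cP : #|P| <= 2 * edit_dist Q T.
  apply: leq_trans (card_pairs D) _; rewrite leq_mul2l /=.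
  by have [h _] := leq_card_setU (Q :\: T) (T :\: Q).
(* A triple is recoded as one of its pairs and the remaining vertex, so a pair in the symmetric
   difference accounts for at most [#|V|] triples. The three recodings and the two orders of a pair
   give the factor 6. *)
have cA (h : V * (V * V) -> (V * V) * V) : injective h ->
    #|[set t | (h t).1 \in P]| <= 2 * edit_dist Q T * #|V|.
  move=> hi; apply: (leq_trans (n := #|setX P [set: V]|)).
    rewrite -(card_imset _ hi); apply: subset_leq_card.
    by apply/subsetP => _ /imsetP[t + ->]; rewrite !inE andbT.
  by rewrite cardsX cardsT leq_mul2r cP orbT.
pose f1 (t : V * (V * V)) := (t.1, t.2.1, t.2.2).
pose f2 (t : V * (V * V)) := (t.1, t.2.2, t.2.1).
pose f3 (t : V * (V * V)) := (t.2.1, t.2.2, t.1).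
have f1i : injective f1 by move=> [x [y z]] [x' [y' z']] [-> -> ->].
have f2i : injective f2 by move=> [x [y z]] [x' [y' z']] [-> -> ->].
have f3i : injective f3 by move=> [x [y z]] [x' [y' z']] [-> -> ->].
have dn i j x y : i != j -> x \in X i -> y \in X j -> x != y.
  move=> ij xi yj; apply: contraTneq xi => ->.
  by rewrite (disjointFl (dX _ _ ij)).
have sub : setX (X (inord 0)) (setX (X (inord 1)) (X (inord 2))) \subset
   [set t | (f1 t).1 \in P] :|: [set t | (f2 t).1 \in P] :|: [set t | (f3 t).1 \in P].
  apply/subsetP => -[x [y z]] h.
  have /and3P[xX yX zX] : [&& x \in X (inord 0), y \in X (inord 1) & z \in X (inord 2)].
    by move: h; rewrite !in_setX.
  (* If [T] agreed with [Q] on the pairs at [z], then [x], [y] and [z] would lie in one class, and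
     [T] would lack the edge of [Q] between [x] and [y]. *)
  clear h; suff h : [|| (x, y) \in P, (x, z) \in P | (y, z) \in P].
    by move: h; rewrite orbA !inE.
  have xy : x != y by apply: dn xX yX; rewrite -val_eqE /= !inordK.
  have xz : x != z by apply: dn xX zX; rewrite -val_eqE /= !inordK.
  have yz : y != z by apply: dn yX zX; rewrite -val_eqE /= !inordK.
  have hP u v : ((u, v) \in P) = (([set u; v] \in Q) != ([set u; v] \in T)).
    have -> : ((u, v) \in P) = ([set u; v] \in D) by rewrite inE.
    by rewrite in_setU !in_setD; do 2 case: (_ \in _).
  rewrite !hP !in_joined h01 // (negbTE (h02 _ _ xX zX)) (negbTE (h12 _ _ yX zX)).
  rewrite xy xz yz !in_set0 /=.
  case: (eqVneq (q x) (q z)) => [->|_] /=; last by rewrite orbT.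
  by rewrite (eq_sym (q z)); case: (q y == q z).
have := subset_leq_card sub; rewrite !cardsX !cX.
set A1 := [set t | (f1 t).1 \in P]; set A2 := [set t | (f2 t).1 \in P].
set A3 := [set t | (f3 t).1 \in P].
have [h1 _] := leq_card_setU A1 A2; have [h2 _] := leq_card_setU (A1 :|: A2) A3.
have := cA _ f1i; have := cA _ f2i; have := cA _ f3i.
rewrite -/A1 -/A2 -/A3 !expnS expn0 muln1 -mulnA.
move: h1 h2; move: #|A1 :|: A2 :|: A3| #|A1 :|: A2| #|A1| #|A2| #|A3| => x1 x2 x3 x4 x5.
move: (a * (a * a)) (edit_dist Q T * #|V|); clear; lia.
Qed.

(** * A partition with an empty class is far from extremal *)

Section Gap.
Variables (VF VH : finType) (EF : {set {set VF}}) (EH : {set {set VH}}) (r : nat).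
Hypothesis r_gt1 : 1 < r.
Hypothesis free_joined : forall (V : finType) (q : V -> 'I_r),
  embs EF (joined set0 q) = set0.
Hypothesis stable : emb_stable EF EH r.

(* Adding a complete bipartite graph inside a large class leaves the graph
   [r]-partite, but puts it far from every complete [r]-partite graph. *)
Lemma stability_gap : exists D n0, 0 < D /\ forall n, n0 <= n ->
  forall q : 'I_n -> 'I_r, (exists j, forall v, q v != j) ->
  exists2 G' : {set {set 'I_n}}, emb_free_graph EF G' &
    D * #|embs EH (joined set0 q)| + n ^ #|VH| < D * #|embs EH G'|.
Proof.
have r0 : 0 < r by exact: ltnW.
(* Below, [n <= 6 * r * a] and the obstruction give [n ^ 2 <= 1296 * r ^ 3] times the edit distance,
   where 1296 is [6 ^ 3 * 6]; the constant is one larger. *)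
have [|D [n0 [D0 hn]]] := stable (K := 1297 * r ^ 3).
  by rewrite muln_gt0 expn_gt0 r0.
exists D, (maxn n0 (6 * r)); split=> // n; rewrite geq_max => /andP[n_n0 n_r] q [j qj].
suff /exists_inP : [exists (G' : {set {set 'I_n}} | emb_free_graph EF G'),
  D * #|embs EH (joined set0 q)| + n ^ #|VH| < D * #|embs EH G'|] by [].
apply: contraT => /exists_inPn no; exfalso.
have [i hi] := large_class q r0; rewrite card_ord in hi.
set Y := [set x | q x == i] in hi.
have [|X [hX dX]] := @disjoint_subsets 'I_3 'I_n (fun=> Y) (#|Y| %/ 3).
  by move=> _; rewrite card_ord mulnC leq_divM.
set a := #|Y| %/ 3 in hX.
have na : n <= 6 * r * a.
  have : #|Y| <= 3 * a + 2.
    have := divn_eq #|Y| 3; have := ltn_pmod #|Y| (isT : 0 < 3); rewrite -/a; lia.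
  move=> hY; have : r * #|Y| <= r * (3 * a + 2) by rewrite leq_mul2l hY orbT.
  move: hi n_r; clear; nia.
pose X0 := X (inord 0); pose X1 := X (inord 1); pose X2 := X (inord 2).
have XY k x : x \in X k -> q x = i.
  by move=> xk; have [/subsetP /(_ x xk)] := hX k; rewrite inE => /eqP.
(* Moving [X0] to the empty class [j] shows that [Q], the old graph with all edges between [X0] and
   [X1] added, is still [r]-partite, hence [F]-free. *)
pose q2 v := if v \in X0 then j else q v.
pose Q := joined set0 q :|: [set e in joined set0 q2 | e \subset X0 :|: X1].
have inQ x y : ([set x; y] \in Q) = (x != y) &&
    ((q x != q y) || [&& q2 x != q2 y, x \in X0 :|: X1 & y \in X0 :|: X1]).
  have -> : ([set x; y] \in Q) = ([set x; y] \in joined set0 q) ||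
      ([set x; y] \in joined set0 q2) && ([set x; y] \subset X0 :|: X1).
    by rewrite in_setU; congr (_ || _); rewrite inE.
  by rewrite !in_joined !in_set0 /= subUset !sub1set -andbA -andb_orr.
have qq2 x y : q x != q y -> q2 x != q2 y.
  rewrite /q2; case: ifP => hx; case: ifP => hy //.
  - by rewrite (XY _ _ hx) (XY _ _ hy) eqxx.
  - by move=> _; rewrite eq_sym qj.
have QT : Q \subset joined set0 q2.
  rewrite subUset; apply/andP; split.
    apply/subsetP => e /joinedP [x [y [xy]]]; rewrite !in_set0 /= => qxy ->.
    by rewrite in_joined xy qq2 ?orbT.
  by apply/subsetP => e; rewrite inE => /andP[].
have gQ : is_graph Q.
  apply/forall_inP => e eQ; have := joined_graph set0 q2.
  by move/forall_inP; apply; apply: (subsetP QT).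
have fQ : emb_free_graph EF Q.
  by rewrite /emb_free_graph gQ -subset0 -(free_joined q2) embs_sub.
(* No competitor beats [joined set0 q] by the gap, and [Q] contains that graph, so [Q] is almost
   extremal and stability applies to it. *)
have [|p hp] := hn n n_n0 Q fQ.
  move=> G' fG'; have := no G' fG'; rewrite -leqNgt => h; apply: leq_trans h _.
  rewrite leq_add2r leq_mul2l subset_leq_card ?orbT //.
  by apply: embs_sub; exact: subsetUl.
have dn k l x : k != l -> x \in X k -> (x \in X l) = false.
  by move=> kl xk; rewrite (disjointFr (dX _ _ kl)).
have i01 : (inord 0 : 'I_3) != inord 1 by rewrite -val_eqE /= !inordK.
have i02 : (inord 0 : 'I_3) != inord 2 by rewrite -val_eqE /= !inordK.
have i12 : (inord 1 : 'I_3) != inord 2 by rewrite -val_eqE /= !inordK.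
have obs : a ^ 3 <= 6 * (edit_dist Q (joined set0 p) * n).
  have := @edit_dist_obstruction _ _ Q p X a (fun k => (hX k).2) dX.
  rewrite card_ord; apply.
  - move=> x y xX yX; rewrite inQ /q2 xX !inE.
    have yX0 : (y \in X0) = false by apply: dn yX; rewrite eq_sym.
    have xy : x != y by apply: contraTneq xX => ->; rewrite /X0 in yX0; rewrite yX0.
    by rewrite yX0 xy xX yX orbT /= (eq_sym j) qj orbT.
  - move=> x z xX zX; rewrite inQ (XY _ _ xX) (XY _ _ zX) eqxx !inE.
    have -> : (z \in X0) = false by apply: dn zX; rewrite eq_sym.
    have -> : (z \in X1) = false by apply: dn zX; rewrite eq_sym.
    by rewrite /= !andbF.
  - move=> x z xX zX; rewrite inQ (XY _ _ xX) (XY _ _ zX) eqxx !inE.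
    have -> : (z \in X0) = false by apply: dn zX; rewrite eq_sym.
    have -> : (z \in X1) = false by apply: dn zX; rewrite eq_sym.
    by rewrite /= !andbF.
have n0' : 0 < n by apply: leq_trans n_r; rewrite muln_gt0 r0.
have : n ^ 3 <= 216 * r ^ 3 * a ^ 3.
  by have : n ^ 3 <= (6 * r * a) ^ 3 by [rewrite leq_exp2r]; rewrite !expnMn.
rewrite (expnS n 2) => h.
have {}h : n ^ 2 <= 1296 * (r ^ 3 * edit_dist Q (joined set0 p)).
  rewrite -(leq_pmul2l n0'); apply: leq_trans h _.
  apply: leq_trans (leq_mul (leqnn _) obs) _; apply: eq_leq; clear; lia.
have : 0 < n ^ 2 by rewrite expn_gt0 n0'.
by move: hp h; rewrite -mulnA; move: (r ^ 3 * _) (n ^ 2); clear; lia.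
Qed.

End Gap.

(** * The structure of an almost complete multipartite graph *)

Lemma card_many_deg (V : finType) (D : {set {set V}}) (S : {set V}) n c :
  {in S, forall v, n <= c * #|[set z | [set v; z] \in D]|} ->
  n * #|S| <= 2 * c * #|D|.
Proof.
move=> hS; apply: (leq_trans (n := \sum_(v in S) c * #|[set z | [set v; z] \in D]|)).
  by rewrite mulnC -sum_nat_const; exact: leq_sum.
rewrite -big_distrr /= (mulnC 2) -mulnA leq_mul2l; apply/orP; right.
apply: leq_trans (sum_deg_le D).
by rewrite [leqRHS](bigID (mem S)) /= leq_addr.
Qed.

Lemma card_cover_edges (V : finType) (P : {set {set V}}) :
  is_graph P -> #|cover P| <= 2 * #|P|.
Proof.
move=> /forall_inP gP; apply: leq_trans (leq_card_bigcup _ _) _.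
rewrite mulnC -sum_nat_const; apply: leq_sum => e eP.
by rewrite (eqP (gP e eP)).
Qed.

(** If a matching cannot be extended, its ends meet every edge. *)
Lemma matching_or_cover (V : finType) (I : {set {set V}}) k : is_graph I ->
  (exists P : {set {set V}}, [/\ P \subset I, #|P| = k.+1 &
     {in P &, forall e e' : {set V}, e != e' -> [disjoint e & e']}]) \/
  (exists2 W : {set V}, #|W| <= 2 * k &
     {in I, forall e : {set V}, exists2 x, x \in e & x \in W}).
Proof.
move=> gI; have gs (P : {set {set V}}) : P \subset I -> is_graph P.
  move=> PI; apply/forall_inP => e eP; move/forall_inP: gI; apply.
  exact: (subsetP PI).
elim: k => [|k [[P [PI cP dP]]|[W cW hW]]].
- case: (set_0Vmem I) => [->|[e eI]].
    by right; exists set0; rewrite ?cards0 // => e; rewrite inE.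
  left; exists [set e]; split; rewrite ?sub1set ?cards1 //.
  by move=> a b; rewrite !inE => /eqP -> /eqP ->; rewrite eqxx.
- case: (boolP [exists e in I, [disjoint e & cover P]]) => [/exists_inP [e eI de]|].
    have deP f : f \in P -> [disjoint e & f].
      move=> fP; apply: disjointWr de; exact: bigcup_sup.
    left; exists (e |: P); split.
    + by rewrite subUset sub1set eI.
    + rewrite cardsU1 cP; suff -> : e \notin P by [].
      apply/negP => /deP; rewrite -setI_eq0 setIid => /eqP e0.
      by move/forall_inP: gI => /(_ e eI); rewrite e0 cards0.
    + move=> a b; rewrite !inE => /predU1P[->|aP] /predU1P[->|bP] ab.
      * by rewrite eqxx in ab.
      * exact: deP.
      * by rewrite disjoint_sym deP.
      * exact: dP.
  rewrite negb_exists_in => /forall_inP h; right; exists (cover P).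
    by rewrite -cP card_cover_edges // gs.
  move=> e eI; have := h e eI; rewrite -setI_eq0 => /set0Pn [x].
  by rewrite inE => /andP[xe xP]; exists x.
- by right; exists W => //; apply: leq_trans cW _; rewrite leq_mul2l leqnSn.
Qed.

(** The arithmetic behind the greedy embedding: for [m] about [n / E], the bad vertices, the used
    images and the missing neighbours together stay below [m]. *)
Lemma greedy_room E f a M m n s :
  4 * E * f.+1 * M <= n -> 4 * E * a <= n -> n < E * m + E ->
  16 * E * f.+1 + s <= n -> E * (a + f + f * M) < E * m.
Proof. by nia. Qed.

Section Structure.
Variables (VF : finType) (EF : {set {set VF}}) (r s : nat).
Hypothesis gF : is_graph EF.
Hypothesis chi_comps : forall C, C \in comps EF -> chi_on C EF <= r.+1.
Hypothesis card_critical : #|critical_comps EF r| = s.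
Hypothesis comps_critical : forall C, C \in comps EF -> chi_on C EF = r.+1 ->
  exists e, color_critical_edge C EF e.
Hypothesis s_gt0 : 0 < s.

Variables (V : finType) (G : {set {set V}}) (p : V -> 'I_r) (K0 K2 : nat).
Let n := #|V|.
Let f := #|VF|.
(** In [E] the summand [16 * K0] makes [m] small against a class, while the other pays for the final
    comparison with factor [K2]. The two terms of [N] serve [A_small] and [Mv_small]. *)
Let K3 := 16 * K0.
Let E := K2 * (4 * K3 + 32 * s * K0) + 16 * K0.
Let E4 := 4 * E * f.+1.
Let N := 8 * E4 * E + 4 * K0 * E.
Hypothesis K0_gt0 : 0 < K0.
Hypothesis n_large : 16 * E * f.+1 + s <= n.
Hypothesis gG : is_graph G.
Hypothesis freeG : embs EF G = set0.
Hypothesis p_large : forall i, n <= K0 * #|[set z | p z == i]|.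
Let D := joined set0 p :\: G.
Hypothesis D_small : N * #|D| <= n ^ 2.

Let nbr v i := #|[set z | (p z == i) && ([set v; z] \in G)]|.
Let m := n %/ E.
(* [B0] consists of the future singleton classes; a vertex outside it is moved
   to a class in which it has few neighbours. [U] collects the vertices whose
   missing edges outweigh all their edges inside their class. *)
Let B0 := [set v | [forall i, m <= nbr v i]].
Let q v := odflt (p v) [pick i | nbr v i < m].
Let Mv := [set v | q v != p v].
Let inn v := #|[set z | (q z == q v) && ([set v; z] \in G)]|.
Let mis v := #|[set z | (q z != q v) && ([set v; z] \notin G)]|.
Let U := [set v | (v \notin B0) && (n <= K3 * mis v)].
Let A := [set v | n < E4 * #|missing G p v|].

Let E_ge : 16 * K0 <= E. Proof. exact: leq_addl. Qed.
Let E_gt0 : 0 < E. Proof. by apply: leq_trans E_ge; rewrite muln_gt0 K0_gt0. Qed.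
Let n_gt0 : 0 < n.
Proof.
by apply: leq_trans n_large; rewrite addn_gt0 s_gt0 orbT.
Qed.

Let Em_le : E * m <= n. Proof. by rewrite mulnC leq_divM. Qed.
Let Em_ge : n < E * m + E. Proof. by rewrite mulnC -mulSnr ltn_ceil. Qed.

Let scale a b x y : a <= b -> b * x <= y -> a * x <= y.
Proof. by move=> ab; apply: leq_trans; rewrite leq_mul2r ab orbT. Qed.

Let q_nbr v : v \notin B0 -> nbr v (q v) < m.
Proof.
rewrite inE => /forallPn [i hi]; rewrite /q; case: pickP => [j //|/(_ i)].
by rewrite ltnNge hi.
Qed.

Let q_B0 v : v \in B0 -> q v = p v.
Proof.
rewrite inE => /forallP h; rewrite /q; case: pickP => [j|//].
by rewrite ltnNge h.
Qed.

(** A moved vertex sees fewer than [m] vertices of its new class, a class of [p] other than its own,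
    so it misses linearly many edges of the complete [r]-partite graph. *)
Let Mv_small : E * #|Mv| <= n.
Proof.
have h : n * #|Mv| <= 2 * (2 * K0) * #|D|.
  apply: card_many_deg => v; rewrite inE => qp.
  have vB : v \notin B0 by apply: contra qp => /q_B0 ->.
  have sub : [set z | p z == q v] \subset
     [set z | [set v; z] \in D] :|: [set z | (p z == q v) && ([set v; z] \in G)].
    apply/subsetP => z; rewrite in_setU inE => /eqP pz.
    rewrite orbC 2!inE pz eqxx /=; case: (boolP (_ \in G)) => //= vz.
    rewrite in_setD vz in_joined !in_set0 /= pz (eq_sym (p v)) qp andbT.
    by apply: contra qp => /eqP vz'; rewrite -pz vz'.
  have h1 := p_large (q v); have h2 := q_nbr vB; have := subset_leq_card sub.
  have [h3 _] := leq_card_setU [set z | [set v; z] \in D]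
     [set z | (p z == q v) && ([set v; z] \in G)].
  have h4 : 2 * K0 * m <= n by apply: scale Em_le; apply: leq_trans E_ge; rewrite leq_mul2r orbT.
  move: h1 h2 h3 h4; rewrite /nbr.
  move: #|[set z | p z == q v]| #|[set z | [set v; z] \in D]| #|_ :|: _| => x y u.
  move: #|_| => w h1 h2 h3 h4 h5.
  have h6 : K0 * x <= K0 * (y + w) by rewrite leq_mul2l (leq_trans h5 h3) orbT.
  have h7 : K0 * w <= K0 * m by rewrite leq_mul2l (ltnW h2) orbT.
  by move: h1 h4 h6 h7; clear; lia.
rewrite -(leq_pmul2l n_gt0) mulnn mulnCA.
apply: leq_trans D_small; apply: leq_trans (_ : E * (2 * (2 * K0) * #|D|) <= _).
  by rewrite leq_mul2l h orbT.
by rewrite mulnA leq_mul2r; apply/orP; right; rewrite /N; clear; lia.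
Qed.

Let A_small : 4 * E * #|A| <= n.
Proof.
have h : n * #|A| <= 2 * E4 * #|D|.
  by apply: card_many_deg => v; rewrite inE => /ltnW.
rewrite -(leq_pmul2l n_gt0) mulnn mulnCA.
apply: leq_trans D_small; apply: leq_trans (_ : 4 * E * (2 * E4 * #|D|) <= _).
  by rewrite leq_mul2l h orbT.
by rewrite mulnA leq_mul2r; apply/orP; right; rewrite /N; clear; lia.
Qed.

(** A neighbour in the same class of [q] was either moved or already in that class under [p]; both
    kinds are few. *)
Let inn_small v : v \notin B0 -> E * inn v <= 2 * n.
Proof.
move=> vB.
have sub : [set z | (q z == q v) && ([set v; z] \in G)] \subset
   Mv :|: [set z | (p z == q v) && ([set v; z] \in G)].
  apply/subsetP => z; rewrite 4!inE => /andP[/eqP qz ->]; rewrite andbT.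
  by rewrite -qz eq_sym orNb.
have h1 := subset_leq_card sub; have h2 := q_nbr vB.
have [h3 _] := leq_card_setU Mv [set z | (p z == q v) && ([set v; z] \in G)].
have : inn v <= #|Mv| + m.
  by apply: leq_trans h1 _; apply: leq_trans h3 _; rewrite leq_add2l ltnW.
rewrite -(leq_pmul2l E_gt0) mulnDr; move: Mv_small Em_le.
by move: (E * inn v) (E * #|Mv|) (E * m); clear; lia.
Qed.

Let q_large i : n <= 2 * K0 * #|[set z | q z == i]|.
Proof.
have sub : [set z | p z == i] \subset Mv :|: [set z | q z == i].
  apply/subsetP => z; rewrite 3!inE => /eqP <-; by rewrite inE orNb.
have h1 := subset_leq_card sub.
have [h3 _] := leq_card_setU Mv [set z | q z == i].
have h2 := leq_trans h1 h3.
have h4 : 2 * K0 * #|Mv| <= n.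
  by apply: scale Mv_small; apply: leq_trans E_ge; rewrite leq_mul2r orbT.
have := p_large i; have : K0 * #|[set z | p z == i]| <= K0 * (#|Mv| + #|[set z | q z == i]|).
  by rewrite leq_mul2l h2 orbT.
move: h4; clear.
by move: #|[set z | p z == i]| #|Mv| #|[set z | q z == i]|; lia.
Qed.

Let m_le_class i : m <= #|[set z | p z == i]|.
Proof.
rewrite -(leq_pmul2l K0_gt0); apply: leq_trans (p_large i).
by apply: scale Em_le; apply: leq_trans E_ge; rewrite leq_pmull.
Qed.

(** Enough disjoint gadget supports for all critical components would produce a copy of [F]. *)
Let force (S : {set {set V}}) : s <= #|S| ->
  {in S &, forall g g' : {set V}, g != g' -> [disjoint g & g']} ->
  {in S, forall g : {set V}, {in critical_comps EF r, forall C, gadget EF G m p C g}} -> False.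
Proof.
move=> cS dS gS.
have : embs EF G != set0; last by rewrite freeG eqxx.
apply: (@gadgets_force _ _ r s gF chi_comps card_critical _ G p m S A (n %/ E4)) => //.
  move=> v; rewrite inE -leqNgt => h.
  have E4_gt0 : 0 < E4 by rewrite /E4 !muln_gt0 E_gt0.
  by rewrite leq_divRL // mulnC.
rewrite -(ltn_pmul2l E_gt0).
have h : E4 * (n %/ E4) <= n by rewrite mulnC leq_divM.
exact: greedy_room h A_small Em_ge n_large.
Qed.

Let S0 := [set [set b] | b in B0].

Let cS0 : #|S0| = #|B0|. Proof. by rewrite card_imset //; exact: set1_inj. Qed.

Let S0_gadget : {in S0, forall g : {set V}, {in critical_comps EF r, forall C, gadget EF G m p C g}}.
Proof.
move=> _ /imsetP [b bB ->] C hC.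
have [e [eF eC cole]] := critical_edge gF comps_critical hC.
apply: (gadget_set1 gF gG eF cole) => i.
by move: bB; rewrite inE => /forallP /(_ i).
Qed.

Let S0_disjoint : {in S0 &, forall g g' : {set V}, g != g' -> [disjoint g & g']}.
Proof.
move=> _ _ /imsetP [b _ ->] /imsetP [b' _ ->] bb'.
by rewrite disjoints1 inE; apply: contra bb' => /eqP ->.
Qed.

Let B0_lt : #|B0| < s.
Proof.
rewrite ltnNge; apply/negP => h; apply: (@force S0) => //; by rewrite cS0.
Qed.

Let I := [set e in G | [forall x in e, (x \notin B0) && (x \notin U)] &&
                       [forall x in e, forall y in e, q x == q y]].

Let in_I x y : [set x; y] \in G -> x \notin B0 -> x \notin U ->
  y \notin B0 -> y \notin U -> q x = q y -> [set x; y] \in I.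
Proof.
move=> xyG xB xU yB yU qxy; rewrite inE xyG /=; apply/andP; split.
  apply/forall_inP => z; rewrite !in_set2.
  by case/orP => /eqP ->; rewrite ?xB ?yB ?xU ?yU.
apply/forall_inP => z zxy; apply/forall_inP => w; move: zxy; rewrite !in_set2.
by case/orP => /eqP -> /orP [] /eqP ->; rewrite ?qxy.
Qed.

(** Both ends lie outside [U], so each misses only a small part of every other class, and their
    common neighbourhood there has at least [m] vertices. *)
Let I_gadget : {in I, forall g : {set V}, {in critical_comps EF r, forall C, gadget EF G m p C g}}.
Proof.
move=> e eI C hC; move: (eI); rewrite inE => /andP[eG /andP[/forall_inP hBU /forall_inP hq]].
have [x [y [xy exy]]] := graph_edgeP gG eG.
have [d [dF dC cold]] := critical_edge gF comps_critical hC.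
have xe : x \in e by rewrite exy set21.
have ye : y \in e by rewrite exy set22.
have qxy : q x = q y by apply/eqP; exact: (forall_inP (hq x xe)).
rewrite exy; apply: (@gadget_set2 _ _ _ _ _ _ _ gF C x y d (q x)) => //.
- exact: critical_not_colorable.
- by rewrite -exy.
move=> i ix.
pose X w := [set z | (p z == i) && ([set w; z] \notin G)].
have cX w : w \in e -> q w = q x -> 16 * K0 * #|X w| <= 2 * n.
  move=> we qw; have sub : X w \subset Mv :|: [set z | (q z != q w) && ([set w; z] \notin G)].
    apply/subsetP => z; rewrite 4!inE => /andP[/eqP pz ->]; rewrite andbT.
    by rewrite pz qw; case: (eqVneq (q z) (q x)) => [->|_]; rewrite ?orbT // eq_sym ix.
  have h1 := subset_leq_card sub.
  have [h2 _] := leq_card_setU Mv [set z | (q z != q w) && ([set w; z] \notin G)].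
  have h3 : #|X w| <= #|Mv| + mis w := leq_trans h1 h2.
  have h4 : 16 * K0 * #|Mv| <= n by exact: scale E_ge Mv_small.
  have h5 : 16 * K0 * mis w <= n.
    have /andP[wB] := hBU w we; rewrite inE wB /= -ltnNge; exact: ltnW.
  apply: leq_trans (_ : 16 * K0 * (#|Mv| + mis w) <= _).
    by rewrite leq_mul2l h3 orbT.
  by rewrite mulnDr mul2n -addnn leq_add.
set T := [set z | _].
have sub : [set z | p z == i] \subset T :|: (X x :|: X y).
  apply/subsetP => z; rewrite inE => pz; rewrite !in_setU.
  have inX w : (z \in X w) = ([set w; z] \notin G) by rewrite inE pz.
  have -> : (z \in T) = ([set x; z] \in G) && ([set y; z] \in G) by rewrite inE pz.
  by rewrite !inX; case: (_ \in G); case: (_ \in G).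
have h1 := subset_leq_card sub.
have [h2 _] := leq_card_setU T (X x :|: X y).
have [h3 _] := leq_card_setU (X x) (X y).
have hx := cX x xe erefl; have hy := cX y ye (esym qxy).
have hP := p_large i; have hm := scale E_ge Em_le.
have hn := n_gt0.
rewrite leqNgt; apply/negP => Tm.
have h4 : #|[set z | p z == i]| <= m + (#|X x| + #|X y|).
  apply: leq_trans h1 _; apply: leq_trans h2 _; exact: leq_add (ltnW Tm) h3.
have : K0 * #|[set z | p z == i]| <= K0 * (m + (#|X x| + #|X y|)).
  by rewrite leq_mul2l h4 orbT.
move: hx hy hP hm hn; move: #|[set z | p z == i]| #|X x| #|X y| m n; clear; lia.
Qed.

Let I_cover : exists2 W : {set V}, #|W| <= 2 * (s - #|B0|.+1) &
     {in I, forall e : {set V}, exists2 x, x \in e & x \in W}.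
Proof.
have gI : is_graph I.
  apply/forall_inP => e; rewrite inE => /andP[eG _]; move/forall_inP: gG; exact.
(* Since [#|B0| < s], the matching [P] would have [s - #|B0|] edges and, with the singletons of
   [B0], supply [s] disjoint gadgets. *)
case: (matching_or_cover (s - #|B0|.+1) gI) => // -[P [PI cP dP]]; exfalso.
have dS0P : {in S0 & P, forall g e : {set V}, [disjoint g & e]}.
  move=> _ e /imsetP[b bB ->] /(subsetP PI); rewrite inE => /andP[_ /andP[/forall_inP h _]].
  by rewrite disjoints1; apply: contraL bB => /h /andP[].
apply: (@force (S0 :|: P)).
- rewrite cardsU; have -> : S0 :&: P = set0.
    apply/setP => e; rewrite in_setI in_set0; apply/negP => /andP[eS eP].
    have := dS0P e e eS eP; rewrite -setI_eq0 setIid => /eqP e0.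
    by move: eS; rewrite e0 => /imsetP[b _ /setP /(_ b)]; rewrite !inE eqxx.
  by rewrite cards0 subn0 cS0 cP; move: B0_lt; clear; lia.
- move=> g g'; rewrite !in_setU => /orP[gS|gP] /orP[gS'|gP'] gg'.
  + exact: S0_disjoint.
  + exact: dS0P.
  + by rewrite disjoint_sym dS0P.
  + exact: dP.
- move=> g; rewrite in_setU => /orP[|/(subsetP PI)]; [exact: S0_gadget | exact: I_gadget].
Qed.

Let U_small (B : {set V}) : n * #|U| <= 2 * K3 * #|joined B q :\: G|.
Proof.
apply: card_many_deg => v; rewrite inE => /andP[_ h]; apply: leq_trans h _.
rewrite leq_mul2l; apply/orP; right; apply: subset_leq_card; apply/subsetP => z.
rewrite inE => /andP[qz vz].
suff : [set v; z] \in joined B q :\: G by rewrite [in X in _ -> X]inE.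
rewrite in_setD vz in_joined (eq_sym (q v)) qz !orbT andbT /=.
by apply: contra qz => /eqP ->.
Qed.

(** A vertex outside [B0] has few neighbours in its own class; turning it into a singleton class
    therefore makes linearly many edges missing. *)
Let new_apex (B : {set V}) w : w \in B -> w \notin B0 -> n <= 8 * K0 * #|joined B q :\: G|.
Proof.
move=> wB wB0; set Dq := joined B q :\: G.
pose Y := [set z | [set w; z] \in Dq].
pose Z := [set z | (q z == q w) && ([set w; z] \in G)].
have sub : [set z | q z == q w] \subset w |: (Z :|: Y).
  apply/subsetP => z; rewrite inE => qz; rewrite in_setU1 in_setU.
  have -> : (z \in Z) = ([set w; z] \in G) by rewrite inE qz.
  have -> : (z \in Y) = ([set w; z] \in Dq) by rewrite inE.
  rewrite in_setD in_joined wB /= andbT eq_sym.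
  by case: (w == z) => //=; case: (_ \in G).
have h1 := subset_leq_card sub; rewrite cardsU1 in h1.
have [h2 _] := leq_card_setU Z Y.
have cY : #|Y| <= #|Dq|.
  have inj : {in Y &, injective (fun z => [set w; z])}.
    move=> z z' zY z'Y /= /set2_eq [[]//|[wz zw]]; by rewrite zw wz.
  rewrite -(card_in_imset inj); apply: subset_leq_card.
  by apply/subsetP => _ /imsetP [z + ->]; rewrite inE.
have hZ : 16 * K0 * #|Z| <= 2 * n by exact: scale E_ge (inn_small wB0).
have hq := q_large (q w).
have h3 : #|[set z | q z == q w]| <= 1 + (#|Z| + #|Dq|).
  apply: leq_trans h1 _; apply: leq_add; first by case: (_ \in _).
  by apply: leq_trans h2 _; rewrite leq_add2l.
have : K0 * #|[set z | q z == q w]| <= K0 * (1 + (#|Z| + #|Dq|)) by rewrite leq_mul2l h3 orbT.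
have : 16 * (16 * K0) <= n.
  apply: leq_trans n_large; apply: leq_trans (leq_addr _ _).
  by rewrite mulnS; apply: leq_trans (leq_addr _ _); rewrite leq_mul2l E_ge orbT.
move: hZ hq; move: #|[set z | q z == q w]| #|Z| #|Dq| n; clear; lia.
Qed.

(** Surplus edges all meet [U] or the cover [W] of [I], at most [2 * n / E] at each vertex, whereas
    [U] and [W] are paid for by linearly many missing edges per vertex, up to constants. *)
Lemma structure_partition : exists (B : {set V}) (q' : V -> 'I_r),
  [/\ #|B| = s - 1, forall i, n <= 2 * K0 * #|[set z | q' z == i]| &
      K2 * #|G :\: joined B q'| <= #|joined B q' :\: G|].
Proof.
have [W cW hW] := I_cover.
have [X XB cX] : exists2 X : {set V}, X \subset ~: B0 & #|X| = s - #|B0|.+1.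
  apply: exists_subset_card; have := cardsC B0; rewrite -/n => h.
  have sn : s <= n by apply: leq_trans n_large; exact: leq_addl.
  by move: h sn; move: #|B0| #|~: B0|; clear; lia.
pose B := B0 :|: X.
have cB : #|B| = s - 1.
  rewrite cardsU; have -> : B0 :&: X = set0.
    by apply/eqP; rewrite setI_eq0 disjoint_sym disjoints_subset.
  by rewrite cards0 subn0 cX; move: B0_lt; clear; lia.
exists B, q; split=> //.
set Dq := joined B q :\: G; set L := G :\: joined B q.
pose S := (U :|: W) :\: B0.
pose F v := [set [set v; z] | z in [set z | (q z == q v) && ([set v; z] \in G)]].
have LF : L \subset \bigcup_(v in S) F v.
  apply/subsetP => e; rewrite in_setD => /andP[eT eG].
  have [x [y [xy exy]]] := graph_edgeP gG eG.
  move: eT; rewrite exy in_joined xy /= !negb_or negbK => /and3P[xB yB /eqP qxy].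
  have xB0 : x \notin B0 by apply: contra xB => h; rewrite in_setU h.
  have yB0 : y \notin B0 by apply: contra yB => h; rewrite in_setU h.
  have Fx : [set x; y] \in F x by apply/imsetP; exists y; rewrite // inE -qxy eqxx -exy.
  have Fy : [set x; y] \in F y by apply/imsetP; exists x; rewrite 1?setUC // inE qxy eqxx setUC -exy.
  case: (boolP (x \in U)) => xU; first by apply/bigcupP; exists x; rewrite // in_setD in_setU xU xB0.
  case: (boolP (y \in U)) => yU; first by apply/bigcupP; exists y; rewrite // in_setD in_setU yU yB0.
  have xyG : [set x; y] \in G by rewrite -exy.
  have [w wxy wW] := hW _ (in_I xyG xB0 xU yB0 yU qxy).
  apply/bigcupP; move: wxy; rewrite in_set2 => /orP[] /eqP ew; rewrite ew in wW.
    by exists x; rewrite // in_setD in_setU wW orbT xB0.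
  by exists y; rewrite // in_setD in_setU wW orbT yB0.
have cL : E * #|L| <= (#|U| + #|W|) * (2 * n).
  apply: leq_trans (_ : E * \sum_(v in S) #|F v| <= _).
    rewrite leq_mul2l; apply/orP; right.
    by apply: leq_trans (subset_leq_card LF) _; exact: leq_card_bigcup.
  rewrite big_distrr /=; apply: leq_trans (_ : \sum_(v in S) 2 * n <= _).
    apply: leq_sum => v; rewrite in_setD => /andP[vB _].
    apply: leq_trans (inn_small vB); rewrite leq_mul2l; apply/orP; right.
    exact: leq_imset_card.
  rewrite sum_nat_const leq_mul2r; apply/orP; right.
  apply: leq_trans (subset_leq_card (subsetDl _ _)) _.
  by have [] := leq_card_setU U W.
have hU := U_small B.
(* If no vertex was added to [B0], then [W] is empty; otherwise an added vertex alone provides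
   linearly many missing edges, and [W] has bounded size. *)
have hWn : n * #|W| <= 16 * s * K0 * #|Dq|.
  case: (posnP #|X|) => [X0|/card_gt0P [w wX]].
    by move: cW; rewrite -cX X0 muln0 leqn0 => /eqP ->; rewrite muln0.
  have wB0 : w \notin B0 by have := subsetP XB w wX; rewrite inE.
  have wB : w \in B by rewrite in_setU wX orbT.
  have h := new_apex wB wB0.
  apply: leq_trans (leq_mul h (_ : #|W| <= 2 * s)) _.
    by apply: leq_trans cW _; rewrite leq_mul2l leq_subr.
  by apply: eq_leq; rewrite -/Dq; move: #|Dq|; clear; lia.
have c_gt0 : 0 < 4 * K3 + 32 * s * K0 by rewrite addn_gt0 /K3 !muln_gt0 K0_gt0.
rewrite -(leq_pmul2l c_gt0).
have h1 : (4 * K3 + 32 * s * K0) * (K2 * #|L|) <= E * #|L|.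
  by rewrite mulnA leq_mul2r; apply/orP; right; rewrite mulnC; exact: leq_addr.
apply: leq_trans h1 _; apply: leq_trans cL _.
move: hU hWn; rewrite -/Dq; move: #|U| #|W| #|Dq| n K3; clear; lia.
Qed.

End Structure.

(** The same structure with the constants chosen before the graph. *)
Lemma extremal_structure (VF : finType) (EF : {set {set VF}}) (r s K0 K2 : nat) :
  is_graph EF ->
  (forall C, C \in comps EF -> chi_on C EF <= r.+1) ->
  #|critical_comps EF r| = s ->
  (forall C, C \in comps EF -> chi_on C EF = r.+1 ->
     exists e, color_critical_edge C EF e) ->
  0 < s -> 0 < K0 ->
  exists N n0, 0 < N /\ forall (V : finType) (G : {set {set V}}) (p : V -> 'I_r),
    n0 <= #|V| -> is_graph G -> embs EF G = set0 ->
    (forall i, #|V| <= K0 * #|[set z | p z == i]|) ->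
    N * #|joined set0 p :\: G| <= #|V| ^ 2 ->
    exists (B : {set V}) (q : V -> 'I_r),
      [/\ #|B| = s - 1, forall i, #|V| <= 2 * K0 * #|[set z | q z == i]| &
          K2 * #|G :\: joined B q| <= #|joined B q :\: G|].
Proof.
move=> gF h1 h2 h3 s0 K00; pose E := K2 * (4 * (16 * K0) + 32 * s * K0) + 16 * K0.
pose E4 := 4 * E * #|VF|.+1.
exists (8 * E4 * E + 4 * K0 * E), (16 * E * #|VF|.+1 + s); split; last first.
  move=> V G p n_large gG fG hp hD.
  exact: (structure_partition gF h1 h2 h3 s0 K00 n_large gG fG hp hD).
rewrite addn_gt0; apply/orP; right.
by rewrite !muln_gt0 K00 /= addn_gt0 !muln_gt0 K00 orbT.
Qed.

(** * Extremal graphs *)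

Section Extremal.
Variables (VF VH : finType) (EF : {set {set VF}}) (EH : {set {set VH}}) (r s : nat).
Hypothesis gF : is_graph EF.
Hypothesis gH : is_graph EH.
Hypothesis r_gt1 : 1 < r.
Hypothesis s_gt1 : 1 < s.
Hypothesis chi_comps : forall C, C \in comps EF -> chi_on C EF <= r.+1.
Hypothesis card_critical : #|critical_comps EF r| = s.
Hypothesis comps_critical : forall C, C \in comps EF -> chi_on C EF = r.+1 ->
  exists e, color_critical_edge C EF e.
Hypothesis stable : emb_stable EF EH r.

Lemma forbidden_neq0 : EF != set0.
Proof.
have /card_gt0P[C hC] : 0 < #|critical_comps EF r|.
  by rewrite card_critical; exact: ltnW.
by have [e [eF _ _]] := critical_edge gF comps_critical hC; apply/set0Pn; exists e.
Qed.

Lemma joined0_free (V : finType) (q : V -> 'I_r) : embs EF (joined set0 q) = set0.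
Proof.
apply: (joined_free gF card_critical _ (leqnn r)).
by rewrite cards0; exact: ltnW.
Qed.

Lemma stability_gap_ex : exists D n0, 0 < D /\ forall n, n0 <= n ->
  forall q : 'I_n -> 'I_r, (exists j, forall v, q v != j) ->
  D * #|embs EH (joined set0 q)| + n ^ #|VH| < D * (#|embs EH EH| * ex n EH EF).
Proof.
have [D [n0 [D0 h]]] := stability_gap r_gt1 joined0_free stable.
exists D, n0; split=> // n nn q hq; have [G fG hG] := h n nn q hq.
by apply: leq_trans hG _; rewrite leq_mul2l ex_max ?orbT.
Qed.

(** With the constant colouring the gap compares against the edgeless graph: an extremal graph has
    more than [n ^ #|VH| / D] embeddings of [H]. *)
Let const_avoids n : exists j : 'I_r, forall v : 'I_n,
  (fun=> Ordinal (ltnW r_gt1)) v != j.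
Proof. by exists (Ordinal r_gt1). Qed.

(** Without edges in [H] all graphs on [n] vertices would have equally many embeddings, against the
    strict gap. *)
Lemma stable_neq0 : EH != set0.
Proof.
apply/negP => /eqP EH0; have [D [n0 [D0 h]]] := stability_gap_ex.
have [G fG eG] := @ex_witness _ _ EF EH n0 forbidden_neq0.
have := h n0 (leqnn _) _ (const_avoids n0).
rewrite -eG -embs_subcount ltnNge => /negP; apply.
apply: leq_trans (leq_addr _ _); rewrite leq_mul2l subset_leq_card ?orbT //.
apply/subsetP => f; rewrite !inE => /andP[-> _] /=.
by apply/forall_inP => e; rewrite EH0 inE.
Qed.

Lemma extremal_joined : exists n0, forall n, n0 <= n ->
  exists (B : {set 'I_n}) (q : 'I_n -> 'I_r),
    [/\ #|B| = s - 1, forall i, #|B| < #|[set x | q x == i]| &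
        ex n EH EF = subcount EH (joined B q)].
Proof.
have s0 : 0 < s by exact: ltnW.
have r0 : 0 < r by exact: ltnW.
have H0 := stable_neq0.
have h2 : 1 < #|VH|.
  have /set0Pn [e eH] := H0; move/forall_inP: gH => /(_ e eH) /eqP <-.
  exact: max_card.
have [D [n1 [D0 gap]]] := stability_gap_ex.
set m := #|EH|; have m0 : 0 < m by rewrite card_gt0.
(* Dissolving a class below [n / K0] costs less than the gap allows. *)
pose K0 := 4 * m * D; have K00 : 0 < K0 by rewrite !muln_gt0 m0 D0.
(* [L] makes [a = n %/ L] small enough for [embs_gain] and [n <= K1 * a]. [K2] balances the loss
   [2 * m * n ^ (#|VH| - 2)] per surplus edge against the gain [a ^ (#|VH| - 2)] per missing
   edge. *)
pose L := 8 * K0 * #|VH|; pose K1 := 2 * L; pose K2 := 2 * m * K1 ^ (#|VH| - 2).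
have [N [n2 [N0 str]]] := extremal_structure K2 gF chi_comps card_critical comps_critical s0 K00.
have [|D' [n3 [D'0 stab]]] := stable (K := K0 * N); first by rewrite muln_gt0 K00.
exists (maxn (maxn n1 n2) (maxn n3 (L + 4 * K0 * (s + 1)))) => n.
rewrite !geq_max => /andP[/andP[n_n1 n_n2] /andP[n_n3 n_big]].
have {}gap := gap n n_n1.
have [G fG eG] := @ex_witness _ _ EF EH n forbidden_neq0.
have /andP[gG /eqP freeG] := fG.
rewrite -eG -embs_subcount in gap.
have maxG (G' : {set {set 'I_n}}) : emb_free_graph EF G' -> #|embs EH G'| <= #|embs EH G|.
  by move=> fG'; rewrite [#|embs EH G|]embs_subcount eG ex_max.
have [|q hq] := stab n n_n3 G fG.
  move=> G' fG'; apply: leq_trans (leq_addr _ _).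
  by rewrite leq_mul2l maxG ?orbT.
pose P := n ^ (#|VH| - 2).
have nh : n ^ #|VH| = n ^ 2 * P by rewrite /P -expnD subnKC.
rewrite nh in gap.
have lip E2 : D * #|embs EH G| <= D * #|embs EH E2| + (2 * m * D * #|G :\: E2|) * P.
  have := embs_lipschitz G E2 gH; rewrite card_ord -/m -/P => h.
  apply: leq_trans (leq_mul (leqnn D) h) _; rewrite mulnDr leq_add2l.
  apply: eq_leq; move: #|_ :\: _| (P); clear; lia.
set T := joined set0 q in hq.
have hGT : K0 * N * #|G :\: T| <= n ^ 2.
  by apply: leq_trans hq; rewrite leq_mul2l leq_addr orbT.
have hTG : N * #|T :\: G| <= n ^ 2.
  apply: leq_trans hq; apply: leq_mul; last exact: leq_addl.
  by rewrite leq_pmull.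
have hGT' : 2 * (2 * m * D * #|G :\: T|) <= n ^ 2.
  apply: leq_trans hGT; rewrite mulnA leq_mul2r; apply/orP; right.
  by apply: leq_trans (_ : K0 <= _); [rewrite /K0; apply: eq_leq; clear; lia | rewrite leq_pmulr].
(* If [T] had no copy of [H], every copy in [G] would use one of the few edges outside [T], too few
   for the gap; an embedding in [T] colours [H]. *)
have colH : colorable_on setT EH r.
  have [f fT] : exists f, f \in embs EH T.
    apply/card_gt0P; rewrite lt0n; apply/eqP => T0.
    have := gap _ (const_avoids n); rewrite ltnNge => /negP; apply.
    apply: leq_trans (lip T) _.
    apply: leq_trans (leq_add (eq_leq (congr1 (muln D) T0)) (leqnn _)) _.
    rewrite muln0 add0n.
    apply: leq_trans (leq_addl (D * _) (n ^ 2 * P)).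
    by rewrite leq_mul2r; apply/orP; right; apply: leq_trans hGT'; exact: leq_pmull.
  move/(embsP _ _ gH): fT => [fi fE]; apply/colorable_onP; exists (q \o f) => x y _ _ /fE.
  by rewrite in_joined !in_set0 => /andP[].
have q_large j : n <= K0 * #|[set z | q z == j]|.
  rewrite leqNgt; apply/negP => small.
  have [j1 j1j] : exists l : 'I_r, l != j.
    case: (eqVneq j (Ordinal r0)) => [->|kr]; last by exists (Ordinal r0); rewrite eq_sym.
    by exists (Ordinal r_gt1).
  (* The small class [j] is merged into [j1]. This cuts only edges at that class, yet leaves [j]
     empty, so the gap applies. *)
  pose q' v := if q v == j then j1 else q v.
  have q'j v : q' v != j by rewrite /q'; case: ifP => // /negbT.
  have := gap q' (ex_intro _ j q'j); rewrite ltnNge => /negP; apply.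
  apply: leq_trans (lip (joined set0 q')) _; rewrite leq_add2l.
  set Y := [set z | q z == j] in small.
  have cut : #|G :\: joined set0 q'| <= #|G :\: T| + #|Y| * n.
    have sub : G :\: joined set0 q' \subset
      (G :\: T) :|: [set [set z.1; z.2] | z in setX Y [set: 'I_n]].
      apply/subsetP => e; rewrite in_setD => /andP[eT eG'].
      rewrite in_setU in_setD eG' andbT; case: (boolP (e \in T)) => //= eT'.
      have [x [y [xy]]] := joinedP eT'; rewrite !in_set0 /= => qxy exy.
      apply/imsetP; move: eT; rewrite exy in_joined xy !in_set0 /= /q'.
      case: (boolP (q x == j)) => qx.
        by move=> _; exists (x, y); rewrite // in_setX !inE qx.
      case: (boolP (q y == j)) => qy; last by rewrite qxy.
      by move=> _; exists (y, x); rewrite /= 1?setUC // in_setX !inE qy.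
    apply: leq_trans (subset_leq_card sub) _.
    have [h _] := leq_card_setU (G :\: T) [set [set z.1; z.2] | z in setX Y [set: 'I_n]].
    apply: leq_trans h _; rewrite leq_add2l; apply: leq_trans (leq_imset_card _ _) _.
    by rewrite cardsX cardsT card_ord.
  have hY : 2 * (2 * m * D * (#|Y| * n)) <= n ^ 2.
    rewrite -mulnn; apply: leq_trans (_ : K0 * #|Y| * n <= _).
      by apply: eq_leq; rewrite /K0; move: #|Y|; clear; lia.
    by rewrite leq_mul2r (ltnW small) orbT.
  have hc : 2 * (2 * m * D * #|G :\: joined set0 q'|) <= 2 * n ^ 2.
    apply: leq_trans (_ : 2 * (2 * m * D * (#|G :\: T| + #|Y| * n)) <= _).
      by rewrite !leq_mul2l cut !orbT.
    by rewrite mulnDr mulnDr [leqRHS]mul2n -addnn leq_add.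
  have {}hc : 2 * m * D * #|G :\: joined set0 q'| <= n ^ 2 by rewrite -(leq_pmul2l (isT : 0 < 2)).
  by rewrite leq_mul2r hc orbT.
have [|||B [q2 [cB q2l hL]]] := str 'I_n G q _ gG freeG.
- by rewrite card_ord.
- by move=> i; rewrite card_ord.
- by rewrite card_ord.
exists B, q2.
set a := n %/ L.
have L0 : 0 < L by rewrite !muln_gt0 m0 D0 /=; exact: ltnW.
have La : L * a <= n by rewrite mulnC leq_divM.
have K1a : n <= K1 * a.
  have : n < L * a + L by rewrite mulnC -mulSnr ltn_ceil.
  have a0 : 0 < a by rewrite divn_gt0 //; apply: leq_trans n_big; exact: leq_addr.
  have : L * 1 <= L * a by rewrite leq_mul2l a0 orbT.
  by rewrite /K1 -mulnA; move: (L * a) (L); clear; lia.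
have class_large i : #|VH| * a + #|B| + 2 <= #|[set x | q2 x == i]|.
  have K08 : 0 < 8 * K0 by rewrite muln_gt0.
  rewrite -(leq_pmul2l K08) cB; move: (q2l i) La n_big; rewrite card_ord /L.
  move: #|[set x | q2 x == i]| s0; clear; nia.
have class_gt i : #|B| < #|[set x | q2 x == i]|.
  by apply: leq_trans (class_large i); rewrite -addnA -addn1; apply: leq_trans (leq_addl _ _); rewrite leq_add2l.
split=> //.
have fT : emb_free_graph EF (joined B q2).
  have B_lt : #|B| < s by rewrite cB; move: s0; clear; lia.
  by rewrite /emb_free_graph joined_graph (joined_free gF card_critical q2 (leqnn r) B_lt) eqxx.
have aut0 := aut_gt0 EH.
suff le_embs : #|embs EH G| <= #|embs EH (joined B q2)|.
  apply/eqP; rewrite eqn_leq; apply/andP; split; last first.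
    rewrite -(leq_pmul2l aut0).
    exact: leq_trans (eq_leq (esym (embs_subcount EH _))) (ex_max EH fT).
  rewrite -eG -(leq_pmul2l aut0).
  exact: leq_trans (eq_leq (esym (embs_subcount EH G)))
    (leq_trans le_embs (eq_leq (embs_subcount EH _))).
set T' := joined B q2 in hL *.
(* [G] is compared with [T'] through their intersection: removing the surplus edges costs at most
   what adding the missing ones gains. *)
have := embs_gain gH H0 colH r_gt1 class_large (subsetIr G T').
have -> : T' :\: (G :&: T') = T' :\: G by rewrite setDIr setDv setU0.
apply: leq_trans; apply: leq_trans (embs_lipschitz G (G :&: T') gH) _.
have -> : G :\: (G :&: T') = G :\: T' by rewrite setDIr setDv set0U.
rewrite leq_add2l card_ord -/m.
apply: leq_trans (leq_mul hL (leqnn _)).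
apply: leq_trans (_ : 2 * m * #|G :\: T'| * (K1 * a) ^ (#|VH| - 2) <= _).
  rewrite leq_mul2l; apply/orP; right.
  by case: (#|VH| - 2) => [//|k]; rewrite leq_exp2r.
apply: eq_leq; rewrite expnMn /K2.
move: #|G :\: T'| (K1 ^ _) (a ^ _); clear; lia.
Qed.

End Extremal.

(** The vertices of [B] are numbered first, one class each, and the classes of [q] are shifted by
    [k]; having more than [#|B|] vertices, these remain nonempty outside [B]. *)
Lemma joined_complete_partite (V : finType) r k l (B : {set V}) (q : V -> 'I_r) :
  #|B| = k -> k + r = l -> (forall i, #|B| < #|[set x | q x == i]|) ->
  exists p : {ffun V -> 'I_l}, complete_partite_by p (joined B q) /\
    forall i : 'I_l, i < k -> #|[set x | p x == i]| = 1.
Proof.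
move=> cB kr hq.
pose g x := if x \in B then index x (enum B) else k + q x.
have idx x : x \in B -> index x (enum B) < k.
  by move=> xB; rewrite -cB cardE index_mem mem_enum.
have gl x : g x < l.
  rewrite /g -kr; case: ifP => [/idx h|_]; last by rewrite ltn_add2l.
  exact: leq_trans h (leq_addr _ _).
pose p := [ffun x => Ordinal (gl x)].
have pE x (i : 'I_l) : (p x == i) = (g x == i) by rewrite ffunE -val_eqE.
have gB x y : x \in B -> (g x == g y) = (x == y).
  move=> xB; apply/eqP/eqP => [|->//]; rewrite /g xB; case: ifP => yB h.
    by rewrite -(nth_index x (s := enum B) (x := x)) ?mem_enum // h nth_index // mem_enum.
  by have := idx x xB; rewrite h ltnNge leq_addr.
have gq x y : (g x != g y) = (x != y) && [|| x \in B, y \in B | q x != q y].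
  case: (boolP (x \in B)) => xB; first by rewrite gB // andbT.
  case: (boolP (y \in B)) => yB; first by rewrite eq_sym gB // eq_sym andbT.
  rewrite /g (negbTE xB) (negbTE yB) eqn_add2l /=.
  by case: (eqVneq x y) => [->|_]; rewrite ?eqxx.
have small (i : 'I_l) : i < k -> exists2 x, x \in B & [set y | p y == i] = [set x].
  move=> ik; have ie : i < size (enum B) by rewrite -cardE cB.
  have /card_gt0P [x0 _] : 0 < #|B| by rewrite cB; exact: leq_ltn_trans ik.
  have xB : nth x0 (enum B) i \in B by rewrite -mem_enum mem_nth.
  have gi : g (nth x0 (enum B) i) = i by rewrite /g xB index_uniq ?enum_uniq.
  move: (nth _ _ _) xB gi => z zB gz; exists z => //; apply/setP => y.
  by rewrite !inE pE -gz eq_sym gB // eq_sym.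
exists p; split; last by move=> i /small [x _ ->]; rewrite cards1.
apply/andP; split.
  apply/forallP => i; apply/existsP; case: (ltnP i k) => ik.
    by have [x _ /setP /(_ x)] := small i ik; rewrite !inE eqxx => h; exists x.
  have ir : i - k < r by rewrite ltn_subLR // kr.
  have /subsetPn [x] : ~~ ([set x | q x == Ordinal ir] \subset B).
    by apply/negP => /subset_leq_card; rewrite leqNgt hq.
  rewrite inE => /eqP qx xB; exists x.
  by rewrite pE /g (negbTE xB) qx /= subnKC.
apply/eqP/setP => e; rewrite !inE; apply: eq_existsb => x; apply: eq_existsb => y.
by rewrite !ffunE -val_eqE /= gq andbA.
Qed.

Theorem theorem1p4 (r s : nat) (VF : finType) (EF : {set {set VF}})
    (VH : finType) (EH : {set {set VH}}) :
  (2 <= r)%N -> (1 < s)%N ->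
  is_graph EF -> is_graph EH ->
  (* every component of F has chromatic number at most r+1 *)
  (forall C, C \in comps EF -> (chi_on C EF <= r.+1)%N) ->
  (* exactly s components have chromatic number r+1 *)
  #|[set C in comps EF | chi_on C EF == r.+1]| = s ->
  (* each of them has a colour-critical edge *)
  (forall C, C \in comps EF -> chi_on C EF = r.+1 ->
     exists e, color_critical_edge C EF e) ->
  weakly_turan_stable EH EF ->
  exists n0 : nat, forall n : nat, (n0 <= n)%N ->
    exists (T : {set {set 'I_n}}) (p : {ffun 'I_n -> 'I_(s + r - 1)}),
      complete_partite_by p T /\
      (forall i : 'I_(s + r - 1), (i < s - 1)%N -> #|[set x | p x == i]| = 1%N) /\
      ex n EH EF = subcount EH T.
Proof.
move=> r2 s1 gF gH hle hcard hcrit hst.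
have s0 : 0 < s by exact: ltnW.
have stable : emb_stable EF EH r.
  apply: weakly_turan_stable_emb hst; first exact: forbidden_neq0 hcard hcrit.
  exact: chi_forbidden hcard s0.
have [n0 hn] := extremal_joined gF gH r2 s1 hle hcard hcrit stable.
exists n0 => n /hn [B [q [cB hB eB]]].
have [|p [hp h1]] := @joined_complete_partite _ r (s - 1) (s + r - 1) B q cB _ hB.
  by rewrite addnBAC.
by exists (joined B q), p.
Qed.
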